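(* Let $H_i,H:[0,T]\times\mathbb{R}^n\times\mathbb{R}^n\to\mathbb{R}$, $i\in\mathbb{N}$, be such that $H_i$ is boundedly admissible with data $(c_i,\lambda_i)$ for each $i$ and $H$ is boundedly admissible with data $(c,\lambda)$ (see context). Let $B$ be the closed unit ball of $\mathbb{R}^{n+1}$ and let $(B,f_i,l_i)$ and $(B,f,l)$ be the canonical compact representations of $H_i$ and $H$, respectively, associated with these data (see context). If for all $t\in[0,T]$ the functions $H_i(t,\cdot,\cdot)$ and $\lambda_i(t,\cdot)$ converge uniformly on compact sets to $H(t,\cdot,\cdot)$ and $\lambda(t,\cdot)$, respectively, and $c_i(t)\to c(t)$, then for all $t\in[0,T]$ the functions $f_i(t,\cdot,\cdot)$ converge to $f(t,\cdot,\cdot)$ and $l_i(t,\cdot,\cdot)$ converge to $l(t,\cdot,\cdot)$ uniformly on compact subsets of $\mathbb{R}^n\times B$.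
   Context: $|\cdot|$ is the Euclidean norm, $B(y,r)$ is the closed ball with center $y$ and radius $r\ge0$, $B_R$ is the closed ball in $\mathbb{R}^n$ centered at $0$ with radius $R$, $d(y,K):=\inf_{z\in K}|y-z|$, $\mathrm{dom}\,\varphi:=\{x:\varphi(x)\ne\pm\infty\}$. A null set is a set of Lebesgue measure zero. A modulus is a function $w:[0,T]\times[0,\infty)\to[0,\infty)$ such that $w(\cdot,r)$ is measurable for every $r\ge0$ and, for every $t$, $w(t,\cdot)$ is nondecreasing, continuous, subadditive and $w(t,0)=0$. For $H:[0,T]\times\mathbb{R}^n\times\mathbb{R}^n\to\mathbb{R}$ put $L(t,x,v):=\sup_{p\in\mathbb{R}^n}\{\langle v,p\rangle-H(t,x,p)\}$ and $E_L(t,x):=\{(v,\eta)\in\mathbb{R}^n\times\mathbb{R}: L(t,x,v)\le\eta\}$. We call $H$ boundedly admissible with data $(c,\lambda)$ if: $H(\cdot,x,p)$ is measurable for all $(x,p)$; $H(t,\cdot,\cdot)$ is continuous for every $t$; $H(t,x,\cdot)$ is convex for every $(t,x)$; $c:[0,T]\to[0,\infty)$ is measurable and $|H(t,x,p)-H(t,x,q)|\le c(t)(1+|x|)|p-q|$ for all $t,x,p,q$; for every $R>0$ there are a measurable $k_R:[0,T]\to[0,\infty)$, a modulus $w_R$ and a null set $\mathcal{N}_R$ such that $|H(t,x,p)-H(t,y,p)|\le k_R(t)|p||x-y|+w_R(t,|x-y|)$ for all $t\in[0,T]\setminus\mathcal{N}_R$, $x,y\in B_R$, $p\in\mathbb{R}^n$;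 and $\lambda:[0,T]\times\mathbb{R}^n\to\mathbb{R}$ is measurable in $t$ for all $x$, continuous in $x$ for all $t$, satisfies $L(t,x,v)\le\lambda(t,x)$ for all $t\in[0,T]$, $x\in\mathbb{R}^n$, $v\in\mathrm{dom}\,L(t,x,\cdot)$, and for every $R>0$ there are a modulus $\tilde w_R$ and a null set $\tilde{\mathcal{N}}_R$ with $|\lambda(t,x)-\lambda(t,y)|\le\tilde w_R(t,|x-y|)$ for $t\in[0,T]\setminus\tilde{\mathcal{N}}_R$, $x,y\in B_R$. (The quantities $k_R,w_R,\dots$ may be different for each $H_i$.) Steiner point: for a nonempty convex compact $K\subset\mathbb{R}^m$ let $\sigma(K,p):=\max_{x\in K}\langle p,x\rangle$, and let $m(\partial\sigma(K,p))$ be the element of minimal norm of the subdifferential of $\sigma(K,\cdot)$ at $p$. Then $s_m(K):=\frac{1}{\mathrm{vol}(B)}\int_{B}m(\partial\sigma(K,p))\,dp\in K$, where $B$ is the closed unit ball of $\mathbb{R}^m$. Canonical compact representation: for $H$ boundedly admissible with data $(c,\lambda)$, put $M(t,x):=|\lambda(t,x)|+|H(t,x,0)|+c(t)(1+|x|)+1$ and, for $a$ in the closed unit ball $B$ of $\mathbb{R}^{n+1}$, $e(t,x,a):=s_{n+1}\big(E_L(t,x)\cap B(M(t,x)a,\,2d(M(t,x)a,E_L(t,x)))\big)\in\mathbb{R}^{n+1}$; define $f(t,x,a)\in\mathbb{R}^n$, $l(t,x,a)\in\mathbb{R}$ by $e(t,x,a)=(f(t,x,a),l(t,x,a))$. The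 triple $(B,f,l)$ is the canonical compact representation of $H$. *)

(* Defs.v *)
From HB Require Import structures.
From mathcomp Require Import all_boot all_order all_algebra.
From mathcomp Require Import all_classical all_reals all_analysis.
From mathcomp Require Import measurable_realfun.

Set Implicit Arguments.
Unset Strict Implicit.
Unset Printing Implicit Defensive.

Import Order.TTheory GRing.Theory Num.Theory.
Import numFieldNormedType.Exports.

Local Open Scope classical_set_scope.
Local Open Scope ring_scope.

(* The library norm of 'rV[R]_n is the sup norm. It induces the same topology
   and uniformity as [enorm], so compactness, continuity and uniform
   convergence on 'rV[R]_n are the usual ones. *)
Section euclidean.
Context {R : realType} {n : nat}.
Implicit Types (x y : 'rV[R]_n) (K : set 'rV[R]_n).

Definition dotp x y : R := \sum_i x 0 i * y 0 i.

Definition enorm x : R := Num.sqrt (dotp x x).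

Definition eball y (r : R) : set 'rV[R]_n := [set x | enorm (x - y) <= r].

Definition edist_set y K : R := inf [set enorm (y - z) | z in K].

End euclidean.

(* Lebesgue measure on R^m, on the (Borel) product sigma-algebra of
   m.-tuple R. *)
Section lebesgue_tuple.
Context {R : realType}.
Local Open Scope ereal_scope.

Definition tuple_of_pair m
    (z : measurableTypeR R * m.-tuple (measurableTypeR R)) :
    m.+1.-tuple (measurableTypeR R) := [tuple of z.1 :: z.2].

Fixpoint lebesgue_tuple m : set (m.-tuple (measurableTypeR R)) -> \bar R :=
  match m with
  | 0 => \d_ [tuple]
  | k.+1 => pushforward (@lebesgue_measure R \x @lebesgue_tuple k)
              (@tuple_of_pair k)
  end.

Lemma measurable_tuple_of_pair m :
  measurable_fun [set: measurableTypeR R * m.-tuple (measurableTypeR R)]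
    (@tuple_of_pair m).
Proof. exact: measurable_cons. Qed.

Let pair_of_tuple m (x : m.+1.-tuple (measurableTypeR R)) :
    measurableTypeR R * m.-tuple (measurableTypeR R) :=
  (thead x, [tuple of behead x]).

Let measurable_pair_of_tuple m : measurable_fun setT (@pair_of_tuple m).
Proof.
apply: measurable_fun_pair; first exact: measurable_tnth.
exact: measurable_behead.
Qed.

Section cons_measure.
Context m (mu : {sigma_finite_measure set (m.-tuple (measurableTypeR R)) -> \bar R}).

Definition cons_measure : set (m.+1.-tuple (measurableTypeR R)) -> \bar R :=
  pushforward (@lebesgue_measure R \x mu) (@tuple_of_pair m).

Let preimage_tuple_of_pair A : measurable A ->
  measurable (@tuple_of_pair m @^-1` A).
Proof.
by move=> mA; rewrite -[X in measurable X]setTI; exact: measurable_tuple_of_pair.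
Qed.

Let cons_measure0 : cons_measure set0 = 0.
Proof. by rewrite /cons_measure /pushforward preimage_set0 measure0. Qed.

Let cons_measure_ge0 A : 0 <= cons_measure A.
Proof. by rewrite /cons_measure /pushforward; exact: measure_ge0. Qed.

Let cons_measure_sigma_additive : semi_sigma_additive cons_measure.
Proof.
move=> F mF tF mUF; rewrite /cons_measure /pushforward preimage_bigcup.
apply: measure_semi_sigma_additive.
- by move=> i; exact: preimage_tuple_of_pair.
- apply/trivIsetP => /= i j _ _ ij; rewrite -preimage_setI.
  by move/trivIsetP : tF => /(_ _ _ _ _ ij) ->//; rewrite preimage_set0.
- by rewrite -preimage_bigcup; exact: preimage_tuple_of_pair.
Qed.

HB.instance Definition _ := isMeasure.Build _ _ _ cons_measure
  cons_measure0 cons_measure_ge0 cons_measure_sigma_additive.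

Let cons_measure_sigma_finite : sigma_finite setT cons_measure.
Proof.
have /sigma_finiteP[F [TF ndF Foo]] := sigma_finiteT (@lebesgue_measure R).
have /sigma_finiteP[G [TG ndG Goo]] := sigma_finiteT mu.
exists (fun i => @pair_of_tuple m @^-1` (F i `*` G i)).
  rewrite -preimage_bigcup -[LHS](preimage_setT (@pair_of_tuple m)).
  congr (_ @^-1` _); rewrite -setXTT TF TG predeqE => -[x y]; split.
    move=> [/= [i _ Fix] [k _ Gky]]; exists (maxn i k) => //; split.
    - by move: x Fix; exact/subsetPset/ndF/leq_maxl.
    - by move: y Gky; exact/subsetPset/ndG/leq_maxr.
  by move=> [i _ []/= ? ?]; split; exists i.
move=> k; have [? ?] := Foo k; have [? ?] := Goo k; split.
  rewrite -[X in measurable X]setTI.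
  by apply: (@measurable_pair_of_tuple m measurableT); exact: measurableX.
rewrite /cons_measure /pushforward -comp_preimage (_ : _ @^-1` _ = F k `*` G k).
  by rewrite product_measure1E// lte_mul_pinfty// ge0_fin_numE.
apply/funext => -[x y]; rewrite /preimage /mkset /=.
by congr (F k _ /\ G k _); exact/val_inj.
Qed.

HB.instance Definition _ := @Measure_isSigmaFinite.Build _ _ _ cons_measure
  cons_measure_sigma_finite.

End cons_measure.

Let lebesgue_tupleE m :
  exists mu : {sigma_finite_measure set (m.-tuple (measurableTypeR R)) -> \bar R},
    @lebesgue_tuple m = mu.
Proof.
elim: m => [|m [mu muE]]; first by exists (\d_ [tuple]).
by exists (cons_measure mu); rewrite /= muE.
Qed.

Let lebesgue_tuple0 m : @lebesgue_tuple m set0 = 0.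
Proof. by have [mu ->] := lebesgue_tupleE m. Qed.

Let lebesgue_tuple_ge0 m A : 0 <= @lebesgue_tuple m A.
Proof. by have [mu ->] := lebesgue_tupleE m. Qed.

Let lebesgue_tuple_sigma_additive m : semi_sigma_additive (@lebesgue_tuple m).
Proof.
by have [mu ->] := lebesgue_tupleE m; exact: measure_semi_sigma_additive.
Qed.

HB.instance Definition _ m := isMeasure.Build _ _ _ (@lebesgue_tuple m)
  (@lebesgue_tuple0 m) (@lebesgue_tuple_ge0 m) (@lebesgue_tuple_sigma_additive m).

Let lebesgue_tuple_sigma_finite m : sigma_finite setT (@lebesgue_tuple m).
Proof. by have [mu ->] := lebesgue_tupleE m; exact: sigma_finiteT. Qed.

HB.instance Definition _ m := @Measure_isSigmaFinite.Build _ _ _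
  (@lebesgue_tuple m) (@lebesgue_tuple_sigma_finite m).

End lebesgue_tuple.

Section steiner.
Context {R : realType} {m : nat}.
Implicit Types (K : set 'rV[R]_m) (p : 'rV[R]_m).

(* The supremum is attained when K is nonempty and compact. *)
Definition support_fun K p : R := sup [set dotp p x | x in K].

Definition subdifferential (phi : 'rV[R]_m -> R) p : set 'rV[R]_m :=
  [set v | forall q, phi p + dotp v (q - p) <= phi q].

(* Such a v is unique when K is nonempty, closed and convex; the default 0 is
   only used when there is none. *)
Definition min_norm K : 'rV[R]_m :=
  xget 0 [set v | K v /\ forall u, K u -> enorm v <= enorm u].

Definition row_of_tuple (p : m.-tuple (measurableTypeR R)) : 'rV[R]_m :=
  \row_i tnth p i.

Definition unit_ball_tuple : set (m.-tuple (measurableTypeR R)) :=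
  row_of_tuple @^-1` eball 0 1.

Definition steiner_point K : 'rV[R]_m :=
  \row_i ((fine (@lebesgue_tuple R m unit_ball_tuple))^-1 *
    \int[@lebesgue_tuple R m]_(p in unit_ball_tuple)
      min_norm (subdifferential (support_fun K) (row_of_tuple p)) 0 i).

End steiner.

(* Measurability for the completed (Lebesgue) sigma-algebra, not only for the
   Borel sets, which are the default on R. *)
Definition Lebesgue_measurable_fun {R : realType} (D : set R) (f : R -> R) :=
  measurable_fun
    (D : set (g_sigma_algebraType (completed_algebra_gen (@lebesgue_measure R))))
    f.

Record modulus {R : realType} (T : R) (w : R -> R -> R) : Prop := {
  modulus_measurable : forall r, 0 <= r ->
    Lebesgue_measurable_fun `[0, T] (w ^~ r) ;
  modulus_ge0 : forall t r, t \in `[0, T] -> 0 <= r -> 0 <= w t r ;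
  modulus_nondecreasing : forall t, t \in `[0, T] ->
    {in `[0, +oo[ &, {homo w t : r s / r <= s}} ;
  modulus_continuous : forall t, t \in `[0, T] ->
    {within `[0, +oo[, continuous (w t)} ;
  modulus_subadditive : forall t, t \in `[0, T] ->
    forall r s, 0 <= r -> 0 <= s -> w t (r + s) <= w t r + w t s ;
  modulus0 : forall t, t \in `[0, T] -> w t 0 = 0
}.

Section hamiltonian.
Context {R : realType} {n : nat}.
Implicit Types (T t : R) (x v p : 'rV[R]_n) (H : R -> 'rV[R]_n -> 'rV[R]_n -> R)
  (c : R -> R) (lam : R -> 'rV[R]_n -> R).

Definition lagrangian H t x v : \bar R :=
  ereal_sup [set (dotp v p - H t x p)%:E | p in [set: 'rV[R]_n]].

Definition dom_lagrangian H t x : set 'rV[R]_n :=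
  [set v | lagrangian H t x v \is a fin_num].

(* (v, eta) in R^n x R is encoded as [row_mx v eta%:M]. *)
Definition epi_lagrangian H t x : set 'rV[R]_(n + 1) :=
  [set z | (lagrangian H t x (lsubmx z) <= (rsubmx z 0 0)%:E)%E].

Record boundedly_admissible T H c lam : Prop := {
  adm_measurable : forall x p, Lebesgue_measurable_fun `[0, T] (fun t => H t x p) ;
  adm_continuous : forall t, t \in `[0, T] ->
    continuous (fun z : 'rV[R]_n * 'rV[R]_n => H t z.1 z.2) ;
  adm_convex : forall t x, t \in `[0, T] ->
    convex_function [set: convex_lmodType 'rV[R]_n] (H t x) ;
  adm_c_measurable : Lebesgue_measurable_fun `[0, T] c ;
  adm_c_ge0 : forall t, t \in `[0, T] -> 0 <= c t ;
  adm_lipschitz : forall t x p q, t \in `[0, T] ->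
    `|H t x p - H t x q| <= c t * (1 + enorm x) * enorm (p - q) ;
  adm_modulus : forall r, 0 < r ->
    exists (k : R -> R) (w : R -> R -> R) (N : set R),
      [/\ Lebesgue_measurable_fun `[0, T] k,
          (forall t, t \in `[0, T] -> 0 <= k t),
          modulus T w,
          (@lebesgue_measure R).-negligible N &
          forall t x y p, t \in `[0, T] -> ~ N t ->
            eball 0 r x -> eball 0 r y ->
            `|H t x p - H t y p|
              <= k t * enorm p * enorm (x - y) + w t (enorm (x - y))] ;
  adm_lam_measurable : forall x, Lebesgue_measurable_fun `[0, T] (lam ^~ x) ;
  adm_lam_continuous : forall t, t \in `[0, T] -> continuous (lam t) ;
  adm_lam_bound : forall t x v, t \in `[0, T] -> dom_lagrangian H t x v ->
    (lagrangian H t x v <= (lam t x)%:E)%E ;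
  adm_lam_modulus : forall r, 0 < r ->
    exists (w : R -> R -> R) (N : set R),
      [/\ modulus T w,
          (@lebesgue_measure R).-negligible N &
          forall t x y, t \in `[0, T] -> ~ N t ->
            eball 0 r x -> eball 0 r y ->
            `|lam t x - lam t y| <= w t (enorm (x - y))]
}.

Definition canonical_radius H c lam t x : R :=
  `|lam t x| + `|H t x 0| + c t * (1 + enorm x) + 1.

Definition canonical_e H c lam t x (a : 'rV[R]_(n + 1)) : 'rV[R]_(n + 1) :=
  let y := canonical_radius H c lam t x *: a in
  let E := epi_lagrangian H t x in
  steiner_point (E `&` eball y (2 * edist_set y E)).

Definition canonical_f H c lam t x a : 'rV[R]_n :=
  lsubmx (canonical_e H c lam t x a).

Definition canonical_l H c lam t x a : R :=
  rsubmx (canonical_e H c lam t x a) 0 0.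

End hamiltonian.

(* Main.v *)
Require Import Defs.
From mathcomp Require Import all_boot all_order all_algebra.
From mathcomp Require Import all_classical all_reals all_analysis.
From mathcomp Require Import measurable_realfun.
From mathcomp Require Import ring lra.
Import Order.TTheory GRing.Theory Num.Theory.
Import numFieldNormedType.Exports.
Local Open Scope classical_set_scope.
Local Open Scope ring_scope.
Set Implicit Arguments.
Unset Strict Implicit.
Unset Printing Implicit Defensive.

(** Fix [t]. Every set involved is built from the epigraph [E] of the Lagrangian,
    which is the intersection of the half-spaces [dotp v p - eta <= H t x p], and
    the value of the representation is the Steiner point of [E] clipped by a ball
    whose radius is twice the distance from its centre [y] to [E]. The proof
    follows the data through this construction along arbitrary sequences [x_ N] to
    [x] and [a_ N] to [a], with the index of the Hamiltonian tending to infinity;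
    on compact sets such sequential convergence is uniform
    ([uniform_cvg_of_sequences]).

    Convergence of the epigraphs. Locally uniform convergence of convex
    Hamiltonians makes their conjugates converge variationally: limits of points
    of the epigraphs stay in the limit epigraph because it is cut out by
    inequalities that pass to the limit, and a point of the limit epigraph is
    recovered by a proximal construction ([conjugate_epi_proximal],
    [conjugate_epi_cvg]), which produces actual subgradients of the approximating
    Hamiltonians close to a given slope.

    Convergence of the clipped sets. The distances to the epigraphs converge, and
    the factor 2 guarantees that the limit epigraph meets the interior of the
    clipping ball as soon as the distance is positive. Together with convexity
    this yields the convergence of the clipped sets ([clip_cvg]), hence, as they
    are uniformly bounded, of their support functions at every point
    ([support_fun_cvg]).

    Convergence of the Steiner points ([steiner_point_cvg]). A support function
    is convex, so on each line parallel to a coordinate axis it has countably many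
    kinks ([countable_kinks_on_line]); by Fubini the set of kinks is null. Off the
    kinks the subgradient is unique, it is a limit of difference quotients, hence
    measurable in [p], and it depends continuously on the support function. The
    Steiner point is the average of these subgradients over the unit ball, and
    the dominated convergence theorem concludes. *)

(** * Euclidean geometry of row vectors *)
Section euclidean_norm.
Context {R : realType} {n : nat}.
Implicit Types (x y z : 'rV[R]_n) (a r : R).

Lemma dotpC x y : dotp x y = dotp y x.
Proof. by apply: eq_bigr => i _; rewrite mulrC. Qed.

Lemma dotpDl x y z : dotp (x + y) z = dotp x z + dotp y z.
Proof. by rewrite /dotp -big_split; apply: eq_bigr => i _; rewrite mxE mulrDl. Qed.

Lemma dotpZl a x y : dotp (a *: x) y = a * dotp x y.
Proof. by rewrite /dotp mulr_sumr; apply: eq_bigr => i _; rewrite mxE mulrA. Qed.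

Lemma dotpNl x y : dotp (- x) y = - dotp x y.
Proof. by rewrite -scaleN1r dotpZl mulN1r. Qed.

Lemma dotpBl x y z : dotp (x - y) z = dotp x z - dotp y z.
Proof. by rewrite dotpDl dotpNl. Qed.

Lemma dotpDr x y z : dotp x (y + z) = dotp x y + dotp x z.
Proof. by rewrite dotpC dotpDl !(dotpC x). Qed.

Lemma dotpZr a x y : dotp x (a *: y) = a * dotp x y.
Proof. by rewrite dotpC dotpZl dotpC. Qed.

Lemma dotpBr x y z : dotp x (y - z) = dotp x y - dotp x z.
Proof. by rewrite dotpC dotpBl !(dotpC x). Qed.

Lemma dotp0r x : dotp x 0 = 0.
Proof. by rewrite -(scale0r 0) dotpZr mul0r. Qed.

Lemma dotp_delta x i : dotp x (delta_mx 0 i) = x 0 i.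
Proof.
rewrite /dotp (bigD1 i)//= big1 ?addr0 ?mxE ?eqxx ?mulr1// => j ji.
by rewrite mxE (negbTE ji) andbF mulr0.
Qed.

Lemma dotp_ge0 x : 0 <= dotp x x.
Proof. by apply: sumr_ge0 => i _; rewrite -expr2 sqr_ge0. Qed.

Lemma enorm_ge0 x : 0 <= enorm x.
Proof. exact: sqrtr_ge0. Qed.

Lemma enorm_sqr x : enorm x ^+ 2 = dotp x x.
Proof. by rewrite sqr_sqrtr// dotp_ge0. Qed.

Lemma enormZ a x : enorm (a *: x) = `|a| * enorm x.
Proof. by rewrite /enorm dotpZl dotpZr mulrA -expr2 sqrtrM ?sqr_ge0// sqrtr_sqr. Qed.

Lemma enormN x : enorm (- x) = enorm x.
Proof. by rewrite -scaleN1r enormZ normrN1 mul1r. Qed.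

Lemma enorm0 : enorm (0 : 'rV[R]_n) = 0.
Proof. by rewrite /enorm dotp0r sqrtr0. Qed.

Lemma enorm_distC x y : enorm (x - y) = enorm (y - x).
Proof. by rewrite -enormN opprB. Qed.

Lemma coord_le_enorm x i : `|x 0 i| <= enorm x.
Proof.
rewrite -sqrtr_sqr ler_wsqrtr// /dotp (bigD1 i)//= -expr2 lerDl.
by apply: sumr_ge0 => j _; rewrite -expr2 sqr_ge0.
Qed.

Lemma enorm_eq0 x : enorm x = 0 -> x = 0.
Proof.
move=> x0; apply/rowP => i; rewrite mxE; apply/normr0_eq0/le_anti.
by rewrite normr_ge0 -[leRHS]x0 coord_le_enorm.
Qed.

Lemma dotp_le_enorm x y : dotp x y <= enorm x * enorm y.
Proof.
have [->|y0] := eqVneq y 0; first by rewrite dotp0r enorm0 mulr0.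
have ny : 0 < enorm y.
  by rewrite lt_neqAle enorm_ge0 andbT eq_sym; apply/contra_neq: y0 => /enorm_eq0.
have := dotp_ge0 (enorm y ^+ 2 *: x - dotp x y *: y).
rewrite !(dotpBl, dotpBr, dotpZl, dotpZr) -!enorm_sqr [dotp y x]dotpC => h.
have {}h : dotp x y ^+ 2 <= (enorm x * enorm y) ^+ 2.
  rewrite -(ler_pM2l (exprn_gt0 2 ny)) -subr_ge0; apply: le_trans h _.
  by rewrite le_eqVlt; apply/orP; left; apply/eqP; ring.
apply: le_trans (ler_norm _) _; rewrite -ler_sqr ?nnegrE// ?mulr_ge0 ?enorm_ge0//.
by rewrite real_normK ?num_real.
Qed.

Lemma ler_enormD x y : enorm (x + y) <= enorm x + enorm y.
Proof.
rewrite -ler_sqr ?nnegrE ?addr_ge0 ?enorm_ge0// enorm_sqr dotpDl !dotpDr.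
rewrite -!enorm_sqr (dotpC y x).
have := dotp_le_enorm x y; nra.
Qed.

Lemma enorm_dist_triangle x y z : enorm (x - z) <= enorm (x - y) + enorm (y - z).
Proof. by rewrite (le_trans _ (ler_enormD _ _))// addrA subrK. Qed.

Lemma mx_norm_le_enorm x : `|x| <= enorm x.
Proof.
rewrite [leLHS]/Num.norm/= mx_normrE; apply/bigmax_leP; split => [|[i j] _ /=].
  exact: enorm_ge0.
by rewrite ord1 coord_le_enorm.
Qed.

Lemma dotp_continuous : continuous (fun z : 'rV[R]_n * 'rV[R]_n => dotp z.1 z.2).
Proof.
move=> z; apply: cvg_big => [|i _]; first by move=> x; exact: add_continuous.
apply: cvgM.
  apply: (@continuous_comp _ _ _ fst (fun x : 'rV[R]_n => x 0 i)); first exact: cvg_fst.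
  exact: coord_continuous.
apply: (@continuous_comp _ _ _ snd (fun x : 'rV[R]_n => x 0 i)); first exact: cvg_snd.
exact: coord_continuous.
Qed.

Lemma cvg_dotp {U : Type} {F : set_system U} {FF : Filter F} (f g : U -> 'rV[R]_n) x y :
  f @ F --> x -> g @ F --> y -> (fun u => dotp (f u) (g u)) @ F --> dotp x y.
Proof.
by move=> fx gy; have := cvg_comp _ _ (cvg_pair fx gy) (@dotp_continuous (x, y)); exact.
Qed.

Lemma dotp_continuousr x : continuous (dotp x).
Proof. by move=> y; apply: (@cvg_dotp _ (nbhs y)) => //; exact: cvg_cst. Qed.

Lemma dotp_continuousl y : continuous (dotp^~ y).
Proof. by move=> x; apply: (@cvg_dotp _ (nbhs x)) => //; exact: cvg_cst. Qed.

Lemma cvg_enorm {U : Type} {F : set_system U} {FF : Filter F} (f : U -> 'rV[R]_n) x :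
  f @ F --> x -> (fun u => enorm (f u)) @ F --> enorm x.
Proof.
by move=> fx; have := cvg_comp _ _ (cvg_dotp fx fx) (@sqrt_continuous R (dotp x x)); exact.
Qed.

Lemma enorm_continuous : continuous (@enorm R n).
Proof. by move=> x; exact: (@cvg_enorm _ (nbhs x)). Qed.

Lemma closed_eball y r : closed (eball y r).
Proof.
rewrite (_ : eball y r = (fun x => enorm (x - y)) @^-1` [set s | s <= r])//.
apply: (preimage_closed _ (@closed_le _ _)) => x _; apply: (@cvg_enorm _ (nbhs x)); apply: cvgB => //; exact: cvg_cst.
Qed.

Lemma compact_eball y r : compact (eball y r).
Proof.
apply: bounded_closed_compact; last exact: closed_eball.
exists (r + enorm y); split; first exact: num_real.
move=> M rM x xr; apply: le_trans (ltW rM); apply: le_trans (mx_norm_le_enorm _) _.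
by rewrite -(subrK y x) (le_trans (ler_enormD _ _))// lerD2r.
Qed.

Lemma nbhs_eball x (e : R) : 0 < e -> \forall z \near x, enorm (z - x) < e.
Proof.
move=> e0; have : enorm (z - x) @[z --> x] --> enorm (x - x).
  by apply: (@cvg_enorm _ (nbhs x)); apply: cvgB => //; exact: cvg_cst.
by rewrite subrr enorm0 => /cvgr_lt h; exact: h.
Qed.

End euclidean_norm.

(** * Integrals and null sets on tuples *)
Section null_set_modification.
Context d (T : measurableType d) (R : realType).
Variable mu : {measure set T -> \bar R}.
Local Open Scope ereal_scope.
Implicit Types (D N : set T) (f g : T -> \bar R).
Import HBNNSimple.

Lemma ge0_le_integral_off_null D N f g : measurable N -> mu N = 0 ->
  (forall x, D x -> 0 <= f x) -> (forall x, D x -> 0 <= g x) ->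
  (forall x, D x -> ~ N x -> f x <= g x) ->
  \int[mu]_(x in D) f x <= \int[mu]_(x in D) g x.
Proof.
move=> mN N0 f0 g0 fg; rewrite !ge0_integralE//.
apply: ge_ereal_sup => _ [h /= hf <-].
have mNC : measurable (~` N) by exact: measurableC.
apply: ereal_sup_ubound; exists (proj_nnsfun h mNC) => [x /=|].
  have [Nx|Nx] := pselect (N x).
    rewrite mindicE memNset ?mulr0; last by rewrite /= => /(_ Nx).
    by rewrite /patch; case: ifPn => // /set_mem /g0.
  rewrite mindicE mem_set ?mulr1//; apply: le_trans (hf x) _.
  by rewrite /patch; case: ifPn => // /set_mem /fg; exact.
rewrite -!integralT_nnsfun; apply: ae_eq_integral => //.
- exact/measurable_EFinP.
- exact/measurable_EFinP.
exists N; split => // x /= /not_implyP[_]; apply: contra_notP => Nx.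
by rewrite mindicE mem_set ?mulr1.
Qed.

(** A simple function below [f] can be set to 0 on a null set without changing
    its integral, so that nonmeasurable integrands are covered. The integrand of
    the Steiner point is one for which measurability is clear only off the null
    set of kinks of the support function. *)
Lemma eq_integral_off_null D N f g : measurable N -> mu N = 0 ->
  (forall x, D x -> ~ N x -> f x = g x) ->
  \int[mu]_(x in D) f x = \int[mu]_(x in D) g x.
Proof.
move=> mN N0 fg; rewrite integralE [RHS]integralE; congr (_ - _).
  by apply/eqP; rewrite eq_le !(@ge0_le_integral_off_null D N)// => x Dx Nx;
    rewrite !funeposE (fg _ Dx Nx).
by apply/eqP; rewrite eq_le !(@ge0_le_integral_off_null D N)// => x Dx Nx;
  rewrite !funenegE (fg _ Dx Nx).
Qed.

End null_set_modification.

Section lebesgue_tuple_null.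
Context {R : realType}.
Local Open Scope ereal_scope.

(** Fubini: after peeling off the coordinates that precede it, the coordinate
    [i] is the first one, and countable sets of reals are null. *)
Lemma lebesgue_tuple_countable_lines m (A : set (m.-tuple (measurableTypeR R)))
    (i : 'I_m) : measurable A ->
  (forall p : m.-tuple (measurableTypeR R), countable [set s : R |
     exists2 q, A q & tnth q i = s /\ forall j, j != i -> tnth q j = tnth p j]) ->
  lebesgue_tuple A = 0.
Proof.
elim: m => [|m IH] in A i * => mA cA; first by case: i cA.
have mA' : measurable (@tuple_of_pair R m @^-1` A).
  by rewrite -[X in measurable X]setTI; exact: measurable_tuple_of_pair.
rewrite /= /pushforward; have [j ij|i0] := unliftP ord0 i.
  apply: integral0_eq => x _ /=.
  rewrite (IH _ j)//; first exact: measurable_xsection.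
  move=> p; apply: sub_countable (cA [tuple of x :: p]); apply: subset_card_le.
  move=> s [q] /=; rewrite /xsection/= inE /= => Aq [qj qp].
  exists (tuple_of_pair (x, q)) => //; rewrite ij; split.
    by rewrite -qj [LHS](tnth_nth 0%R) /= add0n [RHS](tnth_nth 0%R).
  move=> k; have [l ->|->] := unliftP ord0 k => kj.
    have lj : l != j by apply: contraNneq kj => ->.
    by rewrite !(tnth_nth 0%R) /= !add0n -!tnth_nth qp.
  by rewrite !(tnth_nth 0%R).
rewrite (@product_measure_unique _ _ _ _ _ _ _
  (product_measure2 (@lebesgue_measure R) (@lebesgue_tuple R m)))//.
  apply: integral0_eq => p _ /=.
  apply: countable_lebesgue_measure0.
  apply: sub_countable (cA [tuple of 0%R :: p]); apply: subset_card_le.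
  move=> s; rewrite /ysection/= inE /= => Aq.
  exists (tuple_of_pair (s, p)) => //; rewrite i0; split => // k.
  have [l -> _|->] := unliftP ord0 k; last by rewrite eqxx.
  by rewrite !(tnth_nth 0%R).
by move=> B C mB mC; exact: product_measure2E.
Qed.

Definition box m (a : 'I_m -> R) (r : R) : set (m.-tuple (measurableTypeR R)) :=
  [set p | forall i, (`|tnth p i - a i| <= r)%R].

Lemma measurable_box m (a : 'I_m -> R) (r : R) : measurable (box a r).
Proof.
rewrite (_ : box a r = \bigcap_(i in [set: 'I_m])
    ((fun p : m.-tuple (measurableTypeR R) => tnth p i) @^-1`
      `[(a i - r)%R, (a i + r)%R]%classic)).
  apply: fin_bigcap_measurable => // i _; rewrite -[X in measurable X]setTI.
  exact: measurable_tnth.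
apply/seteqP; split => p /= pr i; first by rewrite /= in_itv/= -ler_distl.
by have := pr i I; rewrite /= in_itv/= -ler_distl.
Qed.

Lemma lebesgue_tuple_box_lty m (a : 'I_m -> R) (r : R) :
  lebesgue_tuple (box a r) < +oo.
Proof.
elim: m => [|m IH] in a *; first by rewrite /= diracE ltry.
rewrite /= /pushforward.
rewrite (_ : _ @^-1` _ = `[(a ord0 - r)%R, (a ord0 + r)%R]%classic `*`
    box (a \o lift ord0) r); last first.
  apply/seteqP; split => [[x p] /= xp|[x p] /= [xr pr] i].
    split; first by have := xp ord0; rewrite (tnth_nth 0%R)/= ler_distl in_itv.
    by move=> i; have := xp (lift ord0 i); rewrite !(tnth_nth 0%R).
  have [j ->|->] := unliftP ord0 i.
    by have := pr j; rewrite !(tnth_nth 0%R).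
  by move: xr; rewrite (tnth_nth 0%R)/= in_itv/= -ler_distl.
rewrite product_measure1E//; last exact: measurable_box.
have itv_lty : @lebesgue_measure R `[(a ord0 - r)%R, (a ord0 + r)%R]%classic < +oo.
  by rewrite lebesgue_measure_itv/=; case: ifP => _; rewrite ?EFinN -?EFinD ltry.
by apply: lte_mul_pinfty => //; rewrite ?ge0_fin_numE ?IH.
Qed.

End lebesgue_tuple_null.

Section row_of_tuple_measurability.
Context {R : realType} {m : nat}.
Implicit Types (U : set 'rV[R]_m) (g : 'rV[R]_m -> R).

(** An open set is the union of the countably many boxes with rational centre
    and inverse-integer radius that it contains. *)
Lemma measurable_preimage_open U : open U -> measurable (@row_of_tuple R m @^-1` U).
Proof.
move=> oU.
pose F (i : m.-tuple rat * nat) : set (m.-tuple (measurableTypeR R)) :=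
  box (fun j => ratr (tnth i.1 j)) i.2.+1%:R^-1.
pose G i := if `[< F i `<=` @row_of_tuple R m @^-1` U >] then F i else set0.
rewrite (_ : _ @^-1` U = \bigcup_i G i); last first.
  apply/seteqP; split => [p Up|p [i _]]; last first.
    by rewrite /G; case: asboolP => // FU; exact: FU.
  have /nbhs_ballP[e /= e0 eU] : nbhs (row_of_tuple p) U by exact: open_nbhs_nbhs.
  have [k ke] : exists k : nat, k.+1%:R^-1 + k.+1%:R^-1 < e.
    have e2 : 0 < e / 2 by rewrite divr_gt0.
    have [k _ ke] := near_infty_natSinv_lt (PosNum e2).
    by exists k; rewrite [e]splitr ltrD// (ke k (leqnn k)).
  have /choice[q qp] : forall j : 'I_m, exists q : rat,
      `|tnth p j - ratr q| < k.+1%:R^-1.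
    move=> j; have := @dense_rat R (ball (tnth p j) k.+1%:R^-1).
    case => [||x [/= px [q _ qx]]].
    - by exists (tnth p j); apply: ballxx.
    - exact: ball_open.
    - by exists q; rewrite qx.
  exists ([tuple q i | i < m], k) => //.
  rewrite /G asboolT => [i|]; first by rewrite /= tnth_mktuple ltW.
  move=> p' pp'; apply: eU; split => // i j; rewrite !mxE.
  rewrite /ball/=; have := pp' j; have := qp j; rewrite /= tnth_mktuple => h1 h2.
  rewrite -(subrKA (ratr (q j))) (le_lt_trans (ler_normD _ _))//.
  rewrite (lt_trans _ ke)// ltr_leD// distrC//.
apply: countable_bigcupT_measurable => // i; rewrite /G.
by case: asboolP => _ //; exact: measurable_box.
Qed.

Lemma measurable_fun_row_of_tuple g : continuous g ->
  measurable_fun setT (g \o @row_of_tuple R m).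
Proof.
move=> /continuousP cg; apply: (measurability _ (RGenOpens.measurableE R)).
move=> _ [_ [a [b ->] <-]]; rewrite setTI comp_preimage.
by apply: measurable_preimage_open; apply: cg; exact: interval_open.
Qed.

Lemma measurable_unit_ball_tuple : measurable (@unit_ball_tuple R m).
Proof.
rewrite -(setCK unit_ball_tuple); apply: measurableC.
rewrite /unit_ball_tuple preimage_setC; apply: measurable_preimage_open.
by apply: closed_openC; exact: closed_eball.
Qed.

Lemma lebesgue_unit_ball_tuple_lty : (lebesgue_tuple (@unit_ball_tuple R m) < +oo)%E.
Proof.
apply: le_lt_trans (lebesgue_tuple_box_lty (fun=> 0) 1); apply: le_measure.
- by rewrite inE; exact: measurable_unit_ball_tuple.
- by rewrite inE; exact: measurable_box.
move=> p; rewrite /unit_ball_tuple /preimage /eball/= subr0 => p1 i.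
by apply: le_trans p1; rewrite subr0 (le_trans _ (coord_le_enorm _ i))// mxE.
Qed.

End row_of_tuple_measurability.

(** * Kinks of convex functions *)
Section kinks.
Context {R : realType} {V : lmodType R}.
Implicit Types (phi : V -> R) (e p q : V).

Lemma convex_function_le phi : convex_function [set: convex_lmodType V] phi ->
  forall p q t, 0 <= t -> t <= 1 ->
    phi (t *: p + (1 - t) *: q) <= t * phi p + (1 - t) * phi q.
Proof.
move=> cphi p q t t0 t1.
by have := cphi (Itv01 t0 t1) p q; rewrite !inE => /(_ I I).
Qed.

Definition second_difference phi e p (h : R) : R :=
  phi (p + h *: e) + phi (p - h *: e) - 2 * phi p.

(** The points where the one-sided derivatives of a convex [phi] in the
    direction [e] differ. Stated with second differences, this is a countable
    combination of closed conditions on [p]. *)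
Definition kink phi e : set V := [set p | exists2 eps, 0 < eps &
  forall h, 0 < h -> eps * h <= second_difference phi e p h].

Variable phi : V -> R.
Hypothesis cvx : convex_function [set: convex_lmodType V] phi.

Lemma convex_slope_le e p h h' : 0 < h -> h <= h' ->
  h' * (phi (p + h *: e) - phi p) <= h * (phi (p + h' *: e) - phi p).
Proof.
move=> h0 hh'; have h'0 : 0 < h' := lt_le_trans h0 hh'.
have t0 : 0 <= h / h' by rewrite divr_ge0 ?ltW.
have t1 : h / h' <= 1 by rewrite ler_pdivrMr ?mul1r.
have := convex_function_le cvx (p + h' *: e) p t0 t1.
rewrite scalerDr addrAC -scalerDl subrKC scale1r scalerA divfK ?gt_eqF//.
move=> le_chord; have hE : h' * (h / h') = h by rewrite mulrC divfK ?gt_eqF.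
rewrite -(ler_pM2l h'0) mulrDr (mulrA h') hE (mulrA h') mulrBr mulr1 hE in le_chord.
by lra.
Qed.

Lemma second_difference_slope_le e p h h' : 0 < h -> h <= h' ->
  h' * second_difference phi e p h <= h * second_difference phi e p h'.
Proof.
move=> h0 hh'; have := convex_slope_le e p h0 hh'.
have := convex_slope_le (- e) p h0 hh'.
by rewrite /second_difference !scalerN; lra.
Qed.

Lemma not_kink_near e p eps : ~ kink phi e p -> 0 < eps ->
  exists2 h, 0 < h &
    forall h', 0 < h' -> h' <= h -> second_difference phi e p h' < eps * h'.
Proof.
move=> /forall2NP /(_ eps) []// + e0.
move=> /existsNP[h /not_implyP[h0 /negP]]; rewrite -ltNge => hlt.
exists h => // h' h'0 h'h; rewrite -(ltr_pM2l h0).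
apply: le_lt_trans (second_difference_slope_le e p h'0 h'h) _.
by rewrite (_ : h * (eps * h') = h' * (eps * h)) ?ltr_pM2l//; ring.
Qed.

Lemma kinkE e : kink phi e =
  \bigcup_j \bigcap_k [set p | j.+1%:R^-1 * k.+1%:R^-1 <=
    second_difference phi e p k.+1%:R^-1].
Proof.
apply/seteqP; split => [p [eps eps0 pk]|p [j _ pj]].
  have [j _ je] := near_infty_natSinv_lt (PosNum eps0).
  exists j => // k _ /=; apply: le_trans (pk _ _); last by rewrite invr_gt0.
  by rewrite ler_wpM2r ?invr_ge0// ltW// (je j (leqnn j)).
exists j.+1%:R^-1 => [|h h0]; first by rewrite invr_gt0.
have [k _ kh] := near_infty_natSinv_lt (PosNum h0).
have k0 : 0 < k.+1%:R^-1 :> R by rewrite invr_gt0.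
rewrite -(ler_pM2l k0).
apply: le_trans (second_difference_slope_le e p k0 (ltW (kh k (leqnn k)))).
rewrite (_ : _ * (_ * h) = h * (j.+1%:R^-1 * k.+1%:R^-1)); last by ring.
by rewrite ler_pM2l//; exact: pj.
Qed.

(** At a kink some rational slope lies strictly between the one-sided
    derivatives, and the affine function with this slope touches [phi] at that
    point only; hence distinct kinks on a line have distinct rational slopes. *)
Lemma countable_kinks_on_line p e : countable [set s : R | kink phi e (p + s *: e)].
Proof.
pose touch r : set R := [set s | forall h, h != 0 ->
  phi (p + s *: e) + r * h < phi (p + s *: e + h *: e)].
apply: (@sub_countable _ _ _ (\bigcup_(r : rat) touch (ratr r))); last first.
  apply: bigcup_countable => // r _.
  have [->|/set0P[s rs]] := eqVneq (touch (ratr r)) set0; first exact: countable0.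
  apply: (@sub_countable _ _ _ [set s]); last exact: countable1.
  apply: subset_card_le => s' rs' /=; apply: contrapT => /eqP ss'.
  have := rs (s' - s); have := rs' (s - s').
  rewrite !subr_eq0 ss' eq_sym ss' => /(_ isT) + /(_ isT).
  by rewrite -!addrA -!scalerDl !subrKC; lra.
apply: subset_card_le => s [eps eps0].
set q := p + s *: e => qk.
have slopes h h' : 0 < h -> 0 < h' ->
    eps + (phi q - phi (q - h' *: e)) / h' <= (phi (q + h *: e) - phi q) / h.
  move=> h0 h'0; pose k := Num.min h h'.
  have k0 : 0 < k by rewrite lt_min h0.
  have kh : k <= h by rewrite ge_min lexx.
  have kh' : k <= h' by rewrite ge_min lexx orbT.
  apply: (@le_trans _ _ ((phi (q + k *: e) - phi q) / k)); last first.
    rewrite ler_pdivrMr// mulrAC ler_pdivlMr// mulrC [leRHS]mulrC.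
    exact: convex_slope_le.
  apply: (@le_trans _ _ (eps + (phi q - phi (q - k *: e)) / k)).
    rewrite lerD2l ler_pdivrMr// mulrAC ler_pdivlMr//.
    by have := convex_slope_le (- e) q k0 kh'; rewrite !scalerN; lra.
  rewrite ler_pdivlMr// mulrDl divfK ?gt_eqF//.
  by have := qk k k0; rewrite /second_difference; lra.
pose S := [set (phi q - phi (q - h *: e)) / h | h in [set h : R | 0 < h]].
have supS : has_sup S.
  split; first by exists ((phi q - phi (q - 1 *: e)) / 1), 1 => //=.
  exists ((phi (q + 1 *: e) - phi q) / 1) => _ [h h0 <-].
  by have := slopes 1 h ltr01 h0; lra.
have [//||x [/= px [r _ rx]]] := @dense_rat R `]sup S, sup S + eps[%classic.
- by exists (sup S + eps / 2); rewrite /= in_itv/=; lra.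
- exact: interval_open.
exists r => //= h.
move: px; rewrite -rx in_itv/= => /andP[Sr rS].
rewrite neq_lt => /orP[h0|h0].
  have : (phi q - phi (q - (- h) *: e)) / (- h) < ratr r.
    apply: le_lt_trans Sr; apply: sup_upper_bound => //.
    by exists (- h) => //=; rewrite oppr_gt0.
  by rewrite scaleNr opprK ltr_pdivrMr ?oppr_gt0//; lra.
have : ratr r < (phi (q + h *: e) - phi q) / h.
  apply: lt_le_trans rS _; rewrite -lerBrDr; apply: ge_sup; first by case: supS.
  by move=> _ [h' h'0 <-]; have := slopes h h' h0 h'0; lra.
by rewrite ltr_pdivlMr//; lra.
Qed.

End kinks.

(** * Support functions of compact sets *)
Section support_function.
Context {R : realType} {m : nat}.
Implicit Types (K : set 'rV[R]_m) (p q v : 'rV[R]_m).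

(** The subgradient inequalities at [p + h e_i] and [p - h e_i] confine the [i]-th
    coordinates of [v] and, up to errors that vanish with [N], of [v_ N] to an
    interval of length [second_difference phi e_i p h / h]; off a kink this
    length is as small as desired. *)
Lemma subdifferential_cvg (phi_ : nat -> 'rV[R]_m -> R) (phi : 'rV[R]_m -> R)
    p (v_ : nat -> 'rV[R]_m) v i :
  convex_function [set: convex_lmodType 'rV[R]_m] phi ->
  (forall q, phi_ N q @[N --> \oo] --> phi q) ->
  ~ kink phi (delta_mx 0 i) p ->
  (forall N, subdifferential (phi_ N) p (v_ N)) -> subdifferential phi p v ->
  v_ N 0 i @[N --> \oo] --> v 0 i.
Proof.
move=> cphi phi_cvg pk pv_ pv; apply/cvgrPdist_le => eps eps0.
have [h h0 hk] := not_kink_near cphi pk eps0.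
have {}hk := hk h h0 (lexx h).
have up : phi_ N (p + h *: delta_mx 0 i) - phi_ N p @[N --> \oo] -->
    phi (p + h *: delta_mx 0 i) - phi p by apply: cvgB; exact: phi_cvg.
have down : phi_ N (p - h *: delta_mx 0 i) - phi_ N p @[N --> \oo] -->
    phi (p - h *: delta_mx 0 i) - phi p by apply: cvgB; exact: phi_cvg.
set gap := eps * h - second_difference phi (delta_mx 0 i) p h.
have gap0 : 0 < gap by rewrite subr_gt0.
have sub_up (psi : 'rV[R]_m -> R) u : subdifferential psi p u ->
    h * u 0 i <= psi (p + h *: delta_mx 0 i) - psi p.
  move=> /(_ (p + h *: delta_mx 0 i)).
  by rewrite addrAC subrr add0r dotpZr dotp_delta; lra.
have sub_down (psi : 'rV[R]_m -> R) u : subdifferential psi p u ->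
    - h * u 0 i <= psi (p - h *: delta_mx 0 i) - psi p.
  move=> /(_ (p - h *: delta_mx 0 i)).
  by rewrite addrAC subrr add0r -scaleNr dotpZr dotp_delta; lra.
have := sub_up _ _ pv; have := sub_down _ _ pv => v_down v_up.
near=> N.
have := sub_up _ _ (pv_ N); have := sub_down _ _ (pv_ N) => vN_down vN_up.
have up_lt : phi_ N (p + h *: delta_mx 0 i) - phi_ N p <
    phi (p + h *: delta_mx 0 i) - phi p + gap.
  by near: N; move/cvgr_lt : up; apply; rewrite ltrDl.
have down_lt : phi_ N (p - h *: delta_mx 0 i) - phi_ N p <
    phi (p - h *: delta_mx 0 i) - phi p + gap.
  by near: N; move/cvgr_lt : down; apply; rewrite ltrDl.
move: up_lt down_lt; rewrite /gap /second_difference => up_lt down_lt.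
rewrite ler_distl -(ler_pM2l h0) -[X in _ && X](ler_pM2l h0).
by apply/andP; split; lra.
Unshelve. all: by end_near. Qed.

Lemma subdifferential_coord_unique (phi : 'rV[R]_m -> R) p u v i :
  convex_function [set: convex_lmodType 'rV[R]_m] phi ->
  ~ kink phi (delta_mx 0 i) p ->
  subdifferential phi p u -> subdifferential phi p v -> u 0 i = v 0 i.
Proof.
move=> cphi pk pu pv.
have uv : u 0 i @[_ --> \oo] --> v 0 i.
  exact: (@subdifferential_cvg (fun=> phi) phi p (fun=> u) v i cphi
    (fun q => cvg_cst (phi q)) pk (fun=> pu) pv).
exact: cvg_unique (cvg_cst (u 0 i)) uv.
Qed.

(** As the quotients are continuous in [p], this makes the coordinates of the
    subgradient measurable in [p]. *)
Lemma difference_quotient_cvg (phi : 'rV[R]_m -> R) p v i :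
  convex_function [set: convex_lmodType 'rV[R]_m] phi ->
  ~ kink phi (delta_mx 0 i) p -> subdifferential phi p v ->
  k.+1%:R * (phi (p + k.+1%:R^-1 *: delta_mx 0 i) - phi p) @[k --> \oo] --> v 0 i.
Proof.
move=> cphi pk pv; apply/cvgrPdist_le => eps eps0.
have [h h0 hk] := not_kink_near cphi pk eps0.
near=> k.
have k0 : 0 < k.+1%:R^-1 :> R by rewrite invr_gt0.
have kh : k.+1%:R^-1 <= h.
  by apply: ltW; near: k; exact: near_infty_natSinv_lt (PosNum h0).
have := hk _ k0 kh; rewrite /second_difference.
have := pv (p + k.+1%:R^-1 *: delta_mx 0 i).
have := pv (p - k.+1%:R^-1 *: delta_mx 0 i).
rewrite !(addrAC p _ (- p)) subrr !add0r -scaleNr !dotpZr dotp_delta => v1 v2 kk.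
set q := k.+1%:R * _.
have kq : k.+1%:R^-1 * q = phi (p + k.+1%:R^-1 *: delta_mx 0 i) - phi p.
  by rewrite mulKf ?pnatr_eq0.
rewrite ler_distl -(ler_pM2l k0) -[X in _ && X](ler_pM2l k0).
rewrite !mulrDr kq mulrN; move: v1 v2 kk.
move: (k.+1%:R^-1) => d v1 v2 kk.
by apply/andP; split; lra.
Unshelve. all: by end_near. Qed.

Variable K : set 'rV[R]_m.
Hypothesis (K0 : K !=set0) (cK : compact K).

Lemma support_fun_max p : exists2 x, K x & support_fun K p = dotp p x.
Proof.
have cont := continuous_subspaceT (A := K) (@dotp_continuousr _ _ p).
have [x /set_mem Kx xmax] := EVT_max_rV K0 cK cont; exists x => //.
have ubx : ubound [set dotp p x | x in K] (dotp p x).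
  by move=> _ [y Ky <-]; apply: xmax; exact/mem_set.
apply/eqP; rewrite eq_le; apply/andP; split.
  by apply: ge_sup => //; exists (dotp p x), x.
by apply: ub_le_sup; [exists (dotp p x)|exists x].
Qed.

Lemma support_fun_ub p x : K x -> dotp p x <= support_fun K p.
Proof.
move=> Kx; have [y Ky _] := support_fun_max p; apply: ub_le_sup; last by exists x.
have cont := continuous_subspaceT (A := K) (@dotp_continuousr _ _ p).
have [z /set_mem Kz zmax] := EVT_max_rV K0 cK cont; exists (dotp p z).
by move=> _ [w Kw <-]; apply: zmax; exact/mem_set.
Qed.

Lemma support_funD p q : support_fun K (p + q) <= support_fun K p + support_fun K q.
Proof.
have [x Kx ->] := support_fun_max (p + q).
by rewrite dotpDl lerD// support_fun_ub.
Qed.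

Lemma convex_support_fun :
  convex_function [set: convex_lmodType 'rV[R]_m] (support_fun K).
Proof.
move=> t p q _ _; change (support_fun K (t%:inum *: p + (1 - t%:inum) *: q) <=
  t%:inum * support_fun K p + (1 - t%:inum) * support_fun K q).
have [x Kx ->] := support_fun_max (t%:inum *: p + (1 - t%:inum) *: q).
by rewrite dotpDl !dotpZl lerD// ler_wpM2l ?support_fun_ub// subr_ge0.
Qed.

Lemma support_fun_continuous : continuous (support_fun K).
Proof.
have [r rK] : exists r, forall x, K x -> enorm x <= r.
  have cont := continuous_subspaceT (A := K) (@enorm_continuous R m).
  have [x _ xmax] := EVT_max_rV K0 cK cont.
  by exists (enorm x) => y Ky; apply: xmax; exact/mem_set.
have r0 : 0 <= r by have [x /rK] := K0; exact: le_trans (enorm_ge0 _).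
have lip p q : support_fun K p - support_fun K q <= enorm (p - q) * r.
  rewrite lerBlDr -{1}(subrK q p) (le_trans (support_funD _ _))// lerD2r.
  have [x Kx ->] := support_fun_max (p - q).
  by rewrite (le_trans (dotp_le_enorm _ _))// ler_wpM2l ?enorm_ge0// rK.
move=> p; apply/(@cvgrPdist_lt _ _ _ (nbhs p)) => eps eps0; near=> q.
have small : enorm (q - p) * r < eps.
  rewrite (@le_lt_trans _ _ (enorm (q - p) * (r + 1)))//.
    by rewrite ler_wpM2l ?enorm_ge0 ?lerDl.
  rewrite -ltr_pdivlMr ?ltr_wpDl//; near: q; apply: nbhs_eball.
  by rewrite divr_gt0// ltr_wpDl.
by rewrite ltr_distl; have := lip p q; have := lip q p; rewrite (enorm_distC p q); lra.
Unshelve. all: by end_near. Qed.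

Lemma subdifferential_support_neq0 p : subdifferential (support_fun K) p !=set0.
Proof.
have [x Kx px] := support_fun_max p; exists x => q.
by rewrite px dotpBr !(dotpC x) subrKC support_fun_ub.
Qed.

Lemma subdifferential_support_le p v i : subdifferential (support_fun K) p v ->
  `|v 0 i| <= Num.max (support_fun K (delta_mx 0 i)) (support_fun K (- delta_mx 0 i)).
Proof.
move=> pv; rewrite ler_norml le_max lerNl le_max.
have := pv (p + delta_mx 0 i); have := pv (p - delta_mx 0 i).
rewrite !(addrAC p _ (- p)) subrr !add0r -scaleN1r !dotpZr dotp_delta scaleN1r.
have := support_funD p (delta_mx 0 i); have := support_funD p (- delta_mx 0 i).
move=> up down vdown vup; apply/andP; split; apply/orP; [right|left]; lra.
Qed.

End support_function.

(** * Continuity of the Steiner point *)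
Section steiner_continuity.
Context {R : realType} {m : nat}.
Implicit Types K : set 'rV[R]_m.

Definition kink_tuples K : set (m.-tuple (measurableTypeR R)) :=
  \bigcup_(i : 'I_m) (@row_of_tuple R m @^-1` kink (support_fun K) (delta_mx 0 i)).

Definition support_gradient K p : 'rV[R]_m :=
  min_norm (subdifferential (support_fun K) (row_of_tuple p)).

Section fixed_set.
Variable K : set 'rV[R]_m.
Hypothesis (K0 : K !=set0) (cK : compact K).
Let cvx_sigma := convex_support_fun K0 cK.

Lemma measurable_shifted_support_fun (h : R) i : measurable_fun setT
  (fun p => support_fun K (row_of_tuple p + h *: delta_mx 0 i)).
Proof.
apply: (@measurable_fun_row_of_tuple _ _ (fun q => support_fun K (q + h *: delta_mx 0 i))).
move=> q; have shift : q' + h *: delta_mx 0 i @[q' --> q] --> q + h *: delta_mx 0 i.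
  by apply: (@cvgD _ _ _ (nbhs q)) => //; exact: cvg_cst.
exact: (cvg_comp _ _ shift (@support_fun_continuous _ _ _ K0 cK _)).
Qed.

Lemma measurable_kink i : measurable
  (@row_of_tuple R m @^-1` kink (support_fun K) (delta_mx 0 i)).
Proof.
rewrite (kinkE cvx_sigma) preimage_bigcup; apply: bigcupT_measurable => j.
rewrite preimage_bigcap; apply: bigcapT_measurable => k.
pose f p : R :=
  second_difference (support_fun K) (delta_mx 0 i) (row_of_tuple p) k.+1%:R^-1.
have mf : measurable_fun setT f.
  rewrite /f /second_difference; apply: measurable_funB.
    apply: measurable_funD; first exact: measurable_shifted_support_fun.
    under eq_fun do rewrite -scaleNr.
    exact: measurable_shifted_support_fun.
  apply: measurable_funM => //.
  have := measurable_shifted_support_fun 0 i.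
  by under eq_fun do rewrite scale0r addr0.
rewrite (_ : _ @^-1` _ = f @^-1` `[j.+1%:R^-1 * k.+1%:R^-1, +oo[%classic).
  by rewrite -[X in measurable X]setTI; exact: mf.
by apply/seteqP; split => p /=; rewrite in_itv/= andbT.
Qed.

Lemma lebesgue_kink0 i :
  lebesgue_tuple (@row_of_tuple R m @^-1` kink (support_fun K) (delta_mx 0 i)) = 0%E.
Proof.
apply: (@lebesgue_tuple_countable_lines _ _ _ i); first exact: measurable_kink.
move=> p; pose e : 'rV[R]_m := delta_mx 0 i.
have := countable_kinks_on_line cvx_sigma
  (row_of_tuple p - row_of_tuple p 0 i *: e) e.
apply: sub_countable; apply: subset_card_le => s [q qk [qi qj]] /=.
suff <- : row_of_tuple q = row_of_tuple p - row_of_tuple p 0 i *: e + s *: e by [].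
apply/rowP => j; rewrite /e !mxE eqxx/=.
have [->|ji] := eqVneq j i; first by rewrite qi mulr1 mulr1 subrr add0r.
by rewrite qj// !mulr0 subr0 addr0.
Qed.

Lemma measurable_kink_tuples : measurable (kink_tuples K).
Proof. by apply: fin_bigcup_measurable => // i _; exact: measurable_kink. Qed.

Lemma lebesgue_kink_tuples0 : lebesgue_tuple (kink_tuples K) = 0%E.
Proof.
apply/(negligibleP _ measurable_kink_tuples).
pose F k := if insub k is Some i
  then @row_of_tuple R m @^-1` kink (support_fun K) (delta_mx 0 (i : 'I_m)) else set0.
apply: (@negligibleS _ _ _ _ (\bigcup_k F k)).
  by move=> p [i _ pi]; exists (val i) => //; rewrite /F valK.
apply: negligible_bigcup => k; rewrite /F; case: insubP => [i _ _|_].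
  by apply/(negligibleP _ (measurable_kink i)); exact: lebesgue_kink0.
exact: negligible_set0.
Qed.

Lemma support_gradientP p : ~ kink_tuples K p ->
  subdifferential (support_fun K) (row_of_tuple p) (support_gradient K p).
Proof.
move=> pk; have [v pv] := subdifferential_support_neq0 K0 cK (row_of_tuple p).
have uniq u : subdifferential (support_fun K) (row_of_tuple p) u -> u = v.
  move=> pu; apply/rowP => i.
  by apply: (subdifferential_coord_unique cvx_sigma _ pu pv) => ki; apply: pk; exists i.
rewrite /support_gradient /min_norm; case: xgetP => [w _ []//|/(_ v) []].
by split => // u /uniq ->.
Qed.

Lemma measurable_support_gradient i : measurable_fun setT
  ((fun p => support_gradient K p 0 i) \_ (~` kink_tuples K)).
Proof.
have mC : measurable (~` kink_tuples K).
  by apply: measurableC; exact: measurable_kink_tuples.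
pose quot k p : R := k.+1%:R *
  (support_fun K (row_of_tuple p + k.+1%:R^-1 *: delta_mx 0 i) -
   support_fun K (row_of_tuple p)).
apply: (@measurable_fun_cvg _ _ _ _ (fun k => quot k \_ (~` kink_tuples K))).
  move=> k; apply: (iffLR (measurable_restrictT _ mC)); apply: measurable_funTS.
  apply: measurable_funM => //; apply: measurable_funB.
    exact: measurable_shifted_support_fun.
  have := measurable_shifted_support_fun 0 i.
  by under eq_fun do rewrite scale0r addr0.
move=> p _; rewrite /patch; case: ifPn => [/set_mem pk|_]; last exact: cvg_cst.
apply: difference_quotient_cvg => //; last exact: support_gradientP.
by move=> ki; apply: pk; exists i.
Qed.

Lemma steiner_pointE i : steiner_point K 0 i =
  (fine (lebesgue_tuple (@unit_ball_tuple R m)))^-1 *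
  fine (\int[@lebesgue_tuple R m]_(p in unit_ball_tuple)
    ((fun p => support_gradient K p 0 i) \_ (~` kink_tuples K) p)%:E)%E.
Proof.
rewrite /steiner_point mxE /Rintegral; congr (_ * fine _).
apply: (eq_integral_off_null measurable_kink_tuples lebesgue_kink_tuples0).
by move=> p _ pk; rewrite patchE mem_set.
Qed.

End fixed_set.

(** Off the kinks of all the support functions involved, which form a null set,
    the subgradients are unique and converge. They are bounded by the values of
    the support functions at the coordinate vectors and their opposites, so
    dominated convergence applies. *)
Theorem steiner_point_cvg (K_ : nat -> set 'rV[R]_m) K i :
  (forall N, K_ N !=set0) -> (forall N, compact (K_ N)) ->
  K !=set0 -> compact K ->
  (forall p, support_fun (K_ N) p @[N --> \oo] --> support_fun K p) ->
  steiner_point (K_ N) 0 i @[N --> \oo] --> steiner_point K 0 i.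
Proof.
move=> K_0 cK_ K0 cK K_cvg.
rewrite steiner_pointE//; under eq_fun do rewrite steiner_pointE//.
apply: cvgM; first exact: cvg_cst.
pose g K p : R := ((fun p => support_gradient K p 0 i) \_ (~` kink_tuples K)) p.
have [M MK] : exists M : R, forall N, Num.max (support_fun (K_ N) (delta_mx 0 i))
    (support_fun (K_ N) (- delta_mx 0 i)) <= M.
  have /cvg_seq_bounded/bounded_fun_has_ubound[M1 M1K] : cvgn
    (fun N => support_fun (K_ N) (delta_mx 0 i)) by apply: cvgP (K_cvg _).
  have /cvg_seq_bounded/bounded_fun_has_ubound[M2 M2K] : cvgn
    (fun N => support_fun (K_ N) (- delta_mx 0 i)) by apply: cvgP (K_cvg _).
  exists (Num.max M1 M2) => N; rewrite ge_max !le_max; apply/andP; split; apply/orP.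
    by left; apply: M1K; exists N.
  by right; apply: M2K; exists N.
have [] := @dominated_convergence _ _ _ (@lebesgue_tuple R m) unit_ball_tuple
  measurable_unit_ball_tuple (fun N p => (g (K_ N) p)%:E) (fun p => (g K p)%:E)
  (fun=> `|M|%:E).
- move=> N; apply/measurable_EFinP; apply: measurable_funTS.
  exact: measurable_support_gradient.
- apply/measurable_EFinP; apply: measurable_funTS.
  exact: measurable_support_gradient.
- apply: (@negligibleS _ _ _ _ (kink_tuples K `|` \bigcup_N kink_tuples (K_ N))).
    move=> p /=; apply: contra_notP => /not_orP[pK pK_] _.
    rewrite /g patchE mem_set//; apply: cvg_EFin.
      by apply: nearW.
    have pK_N N : ~ kink_tuples (K_ N) p by move=> pN; apply: pK_; exists N.
    rewrite (_ : _ \o _ = fun N => support_gradient (K_ N) p 0 i); last first.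
      by apply/funext => N /=; rewrite /g patchE mem_set//; exact: pK_N.
    apply: (@subdifferential_cvg _ _ (fun N => support_fun (K_ N)) _
      (row_of_tuple p) (fun N => support_gradient (K_ N) p) _ _
      (convex_support_fun K0 cK) K_cvg).
    + by move=> ki; apply: pK; exists i.
    + by move=> N; apply: support_gradientP => //; exact: pK_N.
    + exact: support_gradientP.
  apply: negligibleU; first apply/negligibleP.
  + exact: measurable_kink_tuples.
  + exact: lebesgue_kink_tuples0.
  apply: negligible_bigcup => N; apply/negligibleP.
  + exact: measurable_kink_tuples.
  + exact: lebesgue_kink_tuples0.
- apply/integrableP; split; first exact: measurable_cst.
  rewrite integral_cst; last exact: measurable_unit_ball_tuple.
  by rewrite lte_mul_pinfty// lebesgue_unit_ball_tuple_lty.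
- apply: aeW => p N _; rewrite lee_fin /g /patch; case: ifPn => [/set_mem pN|_].
    apply: le_trans (ler_norm M); apply: le_trans (MK N).
    by apply: subdifferential_support_le => //; exact: support_gradientP.
  by rewrite normr0.
move=> gint _ gcvg; apply: fine_cvg.
rewrite fineK; first exact: gcvg.
exact: (integrable_fin_num measurable_unit_ball_tuple gint).
Qed.

End steiner_continuity.

(** * Set convergence and clipping *)
Section set_convergence.
Context {R : realType} {m : nat}.
Implicit Types (E K C : set 'rV[R]_m) (x y z p : 'rV[R]_m).

(** Painleve-Kuratowski convergence; the first clause, which says that cluster
    points of points of the [E_ N] lie in [E], is phrased with neighbourhoods so
    that it can be combined with the compactness of a set. *)
Definition kuratowski_cvg (E_ : nat -> set 'rV[R]_m) E :=
  (forall z, ~ E z -> \forall z' \near z & N \near \oo, ~ E_ N z') /\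
  (forall z, E z -> forall eps, 0 < eps ->
    \forall N \near \oo, exists2 z', E_ N z' & enorm (z' - z) < eps).

Lemma kuratowski_cvg_disjoint (E_ : nat -> set 'rV[R]_m) E C :
  kuratowski_cvg E_ E -> compact C -> (forall z, C z -> ~ E z) ->
  \forall N \near \oo, forall z, C z -> ~ E_ N z.
Proof.
move=> [Eup _] cC CE.
apply: (iffLR (compact_near_coveringP C) cC _ _ (fun N z => ~ E_ N z)).
by move=> z /CE; exact: Eup.
Qed.

(** Maximizers of [dotp p] on [K_ N] stay in the compact set [D], so they cannot
    escape from [K]; conversely a maximizer on [K] is approximated. *)
Lemma support_fun_cvg (K_ : nat -> set 'rV[R]_m) K D p :
  (forall N, K_ N !=set0) -> (forall N, compact (K_ N)) ->
  K !=set0 -> compact K -> compact D -> (\forall N \near \oo, K_ N `<=` D) ->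
  kuratowski_cvg K_ K -> support_fun (K_ N) p @[N --> \oo] --> support_fun K p.
Proof.
move=> K_0 cK_ K0 cK cD K_D Kcvg; apply/cvgrPdist_le => eps eps0.
have [x Kx px] := support_fun_max K0 cK p.
have upper : \forall N \near \oo, support_fun (K_ N) p <= support_fun K p + eps.
  have cC : compact (D `&` [set z | support_fun K p + eps <= dotp p z]).
    apply: compact_closedI => //.
    by apply: (preimage_closed _ (@closed_ge _ _)) => z _; exact: dotp_continuousr.
  near=> N; have [z Kz ->] := support_fun_max (K_0 N) (cK_ N) p.
  rewrite leNgt; apply/negP => /ltW zlt; move: Kz.
  suff /(_ z) : forall z, (D `&` [set z | support_fun K p + eps <= dotp p z]) z ->
      ~ K_ N z.
    move=> /[swap] Kz; apply => //; split => //.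
    by move: z Kz {zlt}; near: N.
  near: N; apply: (kuratowski_cvg_disjoint Kcvg cC) => z [_ /=] + Kz.
  by have := support_fun_ub K0 cK p Kz; lra.
have lower : \forall N \near \oo, support_fun K p - eps <= support_fun (K_ N) p.
  have e0 : 0 < eps / (enorm p + 1) by rewrite divr_gt0// ltr_wpDl// enorm_ge0.
  near=> N.
  have [z Kz zx] : exists2 z, K_ N z & enorm (z - x) < eps / (enorm p + 1).
    by near: N; exact: (Kcvg.2 _ Kx _ e0).
  apply: le_trans (support_fun_ub (K_0 N) (cK_ N) p Kz).
  rewrite px lerBlDr -lerBlDl -dotpBr (le_trans (dotp_le_enorm _ _))//.
  move: zx; rewrite ltr_pdivlMr ?ltr_wpDl ?enorm_ge0// enorm_distC => /ltW.
  by apply: le_trans; rewrite mulrC ler_wpM2l ?enorm_ge0 ?lerDl.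
near=> N; rewrite ler_distlC; apply/andP; split; near: N.
  exact: lower.
exact: upper.
Unshelve. all: by end_near. Qed.

Lemma edist_set_ge0 y E : 0 <= edist_set y E.
Proof.
have [->|/set0P[z Ez]] := eqVneq E set0; first by rewrite /edist_set image_set0 inf0.
by apply: lb_le_inf => [|_ [u _ <-]]; [exists (enorm (y - z)), z|exact: enorm_ge0].
Qed.

Lemma edist_set_le y z E : E z -> edist_set y E <= enorm (y - z).
Proof.
move=> Ez; apply: ge_inf; last by exists z.
by exists 0 => _ [u _ <-]; exact: enorm_ge0.
Qed.

Lemma edist_set_adherent y E eps : E !=set0 -> 0 < eps ->
  exists2 z, E z & enorm (y - z) < edist_set y E + eps.
Proof.
move=> [z Ez] eps0; have [|_ [u Eu <-] ulty] := @inf_adherent _ [set enorm (y - z) | z in E] _ eps0.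
  by split; [exists (enorm (y - z)), z|exists 0 => _ [u _ <-]; exact: enorm_ge0].
by exists u.
Qed.

Lemma edist_set_attained y E : closed E -> E !=set0 ->
  exists2 z, E z & enorm (y - z) = edist_set y E.
Proof.
move=> cE E0.
have [u Eu yu] := edist_set_adherent y E0 ltr01.
have cK : compact (eball y (edist_set y E + 1) `&` E).
  by apply: compact_closedI => //; exact: compact_eball.
have K0 : eball y (edist_set y E + 1) `&` E !=set0.
  by exists u; split => //; rewrite /eball/= enorm_distC ltW.
have cont : {within eball y (edist_set y E + 1) `&` E, continuous (fun z => enorm (y - z))}.
  apply: continuous_subspaceT => z; apply: (@cvg_enorm _ _ _ (nbhs z)).
  by apply: cvgB => //; exact: cvg_cst.
have [z /set_mem[_ Ez] zmin] := EVT_min_rV K0 cK cont; exists z => //.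
apply/eqP; rewrite eq_le edist_set_le// andbT; apply/ler_addgt0Pr => eps eps0.
have [w Ew yw] := edist_set_adherent y E0 eps0.
have [w1|w1] := leP (enorm (w - y)) (edist_set y E + 1).
  by apply: le_trans (ltW yw); apply: zmin; apply/mem_set.
have zu : enorm (y - z) <= enorm (y - u).
  by apply: zmin; apply/mem_set; split => //; rewrite /eball/= enorm_distC ltW.
by move: w1; rewrite enorm_distC; lra.
Qed.

Section clip.
Variables (E_ : nat -> set 'rV[R]_m) (E : set 'rV[R]_m).
Variables (y_ : nat -> 'rV[R]_m) (y : 'rV[R]_m).
Hypothesis E_0 : forall N, E_ N !=set0.
Hypothesis E_closed : forall N, closed (E_ N).
Hypothesis E0 : E !=set0.
Hypothesis Eclosed : closed E.
Hypothesis Ecvg : kuratowski_cvg E_ E.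
Hypothesis ycvg : y_ N @[N --> \oo] --> y.

Let dist_y_cvg eps : 0 < eps -> \forall N \near \oo, enorm (y_ N - y) < eps.
Proof. by move=> eps0; exact: (ycvg (nbhs_eball y eps0)). Qed.

Lemma edist_set_cvg : edist_set (y_ N) (E_ N) @[N --> \oo] --> edist_set y E.
Proof.
apply/cvgrPdist_le => eps eps0.
have e3 : 0 < eps / 3 by rewrite divr_gt0.
have [z Ez yz] := edist_set_adherent y E0 e3.
have far : \forall N \near \oo, forall z, eball y (edist_set y E - eps / 3) z -> ~ E_ N z.
  apply: (kuratowski_cvg_disjoint Ecvg); first exact: compact_eball.
  move=> u; rewrite /eball/= => + Eu; have := edist_set_le y Eu.
  by rewrite enorm_distC; lra.
near=> N.
have yN : enorm (y_ N - y) < eps / 3 by near: N; exact: dist_y_cvg.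
rewrite ler_distlC; apply/andP; split.
  have [u Eu <-] := edist_set_attained (y_ N) (@E_closed N) (E_0 N).
  have : ~ eball y (edist_set y E - eps / 3) u.
    by move=> yu; have := Eu; move: u yu {Eu}; near: N.
  move/negP; rewrite -ltNge (enorm_distC u) => yu.
  by have := enorm_dist_triangle y (y_ N) u; rewrite (enorm_distC y (y_ N)); lra.
have [u Eu uz] : exists2 u, E_ N u & enorm (u - z) < eps / 3.
  by near: N; exact: Ecvg.2.
have := edist_set_le (y_ N) Eu.
have := enorm_dist_triangle (y_ N) y u; have := enorm_dist_triangle y z u.
by rewrite (enorm_distC z u); lra.
Unshelve. all: by end_near. Qed.

Definition clip y E : set 'rV[R]_m := E `&` eball y (2 * edist_set y E).

Lemma clip_neq0 x C : closed C -> C !=set0 -> clip x C !=set0.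
Proof.
move=> cC C0; have [z Cz xz] := edist_set_attained x cC C0; exists z; split => //.
by rewrite /eball/= enorm_distC xz; have := edist_set_ge0 x C; lra.
Qed.

Lemma compact_clip x C : closed C -> compact (clip x C).
Proof. by move=> cC; rewrite /clip setIC; apply: compact_closedI => //; exact: compact_eball. Qed.

Hypothesis Econvex : forall x z t, 0 <= t -> t <= 1 -> E x -> E z ->
  E (t *: x + (1 - t) *: z).

(** If [y] is at positive distance from [E], every point of [clip y E] can be
    moved slightly along a segment of the convex set [E] into the interior of the
    ball, where nearby points of [E_ N] are clipped points too. If the distance is
    0, the clipped sets shrink to the point [y]. *)
Lemma clip_cvg : kuratowski_cvg (fun N => clip (y_ N) (E_ N)) (clip y E).
Proof.
have dcvg := edist_set_cvg.
split => z.
  move=> /not_andP[nE|/negP].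
    by have := Ecvg.1 _ nE; apply: filterS => -[z' N] /= nE' [/nE'].
  rewrite -ltNge => zfar.
  have [e [e0 ez]] : exists e, 0 < e /\ 2 * edist_set y E + 4 * e < enorm (z - y).
    by exists ((enorm (z - y) - 2 * edist_set y E) / 5); split; lra.
  near=> z' N => -[_]; apply/negP; rewrite -ltNge.
  have zz' : enorm (z' - z) < e by near: z'; exact: nbhs_eball.
  have yN : enorm (y_ N - y) < e by near: N; exact: dist_y_cvg.
  have dN : edist_set (y_ N) (E_ N) < edist_set y E + e.
    by near: N; move/cvgr_lt : dcvg; apply; rewrite ltrDl.
  have := enorm_dist_triangle z z' y; have := enorm_dist_triangle z' (y_ N) y.
  by rewrite (enorm_distC z z'); lra.
move=> [Ez yz] eps eps0; rewrite /eball/= in yz.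
have [d0|d0] := eqVneq (edist_set y E) 0.
  have zy : z = y.
    apply/eqP; rewrite -subr_eq0; apply/eqP/enorm_eq0/le_anti.
    by rewrite enorm_ge0 andbT; move: yz; rewrite d0 mulr0.
  have e3 : 0 < eps / 3 by rewrite divr_gt0.
  near=> N; have [u Nu] := clip_neq0 (y_ N) (@E_closed N) (E_0 N).
  exists u => //; rewrite zy.
  have yN : enorm (y_ N - y) < eps / 3 by near: N; exact: dist_y_cvg.
  have dN : edist_set (y_ N) (E_ N) < eps / 3.
    by near: N; move/cvgr_lt : dcvg; apply; rewrite d0.
  move: Nu => [_]; rewrite /eball/= => uy.
  by have := enorm_dist_triangle u (y_ N) y; lra.
have {}d0 : 0 < edist_set y E by rewrite lt_neqAle eq_sym d0 edist_set_ge0.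
set d := edist_set y E in d0 yz dcvg *.
have [w Ew yw] := edist_set_attained y Eclosed E0.
(* the point a fraction [t] of the way from [z] to the projection [w] of [y] is
   within [eps / 2] of [z], and [t * d] inside the clipping ball *)
pose t := Num.min 1 (eps / (2 * (3 * d))).
have t0 : 0 < t by rewrite lt_min ltr01 divr_gt0// !mulr_gt0.
have t1 : t <= 1 by rewrite ge_min lexx.
have td : t * (3 * d) <= eps / 2.
  rewrite -ler_pdivlMr ?mulr_gt0// ge_min; apply/orP; right.
  by rewrite invfM mulrA.
have Ex := Econvex (ltW t0) t1 Ew Ez.
set x := t *: w + (1 - t) *: z in Ex.
have xz : enorm (x - z) <= eps / 2.
  have -> : x - z = t *: (w - z).
    by rewrite /x scalerBl scale1r scalerBr -addrA (addrAC z) subrr sub0r.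
  rewrite enormZ (ger0_norm (ltW t0)); apply: le_trans td; rewrite ler_pM2l//.
  by have := enorm_dist_triangle w y z; rewrite (enorm_distC w y) (enorm_distC y z) yw -/d; lra.
have xy : enorm (x - y) <= 2 * d - t * d.
  have -> : x - y = t *: (w - y) + (1 - t) *: (z - y).
    by rewrite !scalerBr addrACA -opprD -scalerDl subrKC scale1r.
  rewrite (le_trans (ler_enormD _ _))// !enormZ (ger0_norm (ltW t0)) ger0_norm ?subr_ge0//.
  rewrite (enorm_distC w) yw -/d.
  have : (1 - t) * enorm (z - y) <= (1 - t) * (2 * d) by rewrite ler_wpM2l ?subr_ge0.
  lra.
pose e := Num.min (eps / 2) (t * d / 4).
have e0 : 0 < e by rewrite lt_min !divr_gt0// mulr_gt0.
have e1 : e <= eps / 2 by rewrite ge_min lexx.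
have e2 : e <= t * d / 4 by rewrite ge_min lexx orbT.
near=> N.
have [u Eu ux] : exists2 u, E_ N u & enorm (u - x) < e by near: N; exact: Ecvg.2.
have yN : enorm (y_ N - y) < e by near: N; exact: dist_y_cvg.
have dN : d - e < edist_set (y_ N) (E_ N).
  by near: N; move/cvgr_gt : dcvg; apply; rewrite ltrBlDr ltrDl.
exists u; last by have := enorm_dist_triangle u x z; lra.
split => //; rewrite /eball/=.
have := enorm_dist_triangle u x (y_ N); have := enorm_dist_triangle x y (y_ N).
by rewrite (enorm_distC y (y_ N)); lra.
Unshelve. all: by end_near. Qed.

(** The clipped sets are nonempty, compact and eventually contained in a
    common ball, so their support functions converge. *)
Lemma steiner_point_clip_cvg i :
  steiner_point (clip (y_ N) (E_ N)) 0 i @[N --> \oo] -->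
  steiner_point (clip y E) 0 i.
Proof.
apply: steiner_point_cvg.
- by move=> N; exact: clip_neq0.
- by move=> N; exact: compact_clip.
- exact: clip_neq0.
- exact: compact_clip.
move=> p; apply: (@support_fun_cvg _ _ (eball y (2 * edist_set y E + 3))).
- by move=> N; exact: clip_neq0.
- by move=> N; exact: compact_clip.
- exact: clip_neq0.
- exact: compact_clip.
- exact: compact_eball.
- near=> N => u [_]; rewrite /eball/= => uy.
  have yN : enorm (y_ N - y) < 1 by near: N; exact: dist_y_cvg.
  have dN : edist_set (y_ N) (E_ N) < edist_set y E + 1.
    by near: N; move/cvgr_lt : edist_set_cvg; apply; rewrite ltrDl.
  by have := enorm_dist_triangle u (y_ N) y; lra.
- exact: clip_cvg.
Unshelve. all: by end_near. Qed.

End clip.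
End set_convergence.

(** * Epigraphs of conjugates *)
Section conjugate_epigraph.
Context {R : realType} {n : nat}.
Implicit Types (G : 'rV[R]_n -> R) (p q v : 'rV[R]_n) (z : 'rV[R]_(n + 1)).

(** The epigraph of the conjugate of [G], as an intersection of half-spaces. *)
Definition conjugate_epi G : set 'rV[R]_(n + 1) :=
  [set z | forall p, dotp z (row_mx p (- 1%:M)) <= G p].

Lemma dotp_row_mx z p : dotp z (row_mx p (- 1%:M)) = dotp (lsubmx z) p - rsubmx z 0 0.
Proof.
rewrite /dotp big_split_ord/=; congr (_ + _).
  by apply: eq_bigr => i _; rewrite row_mxEl mxE.
by rewrite big_ord1 row_mxEr !mxE eqxx mulrN1.
Qed.

Lemma enorm_row_mx v (s : R) : enorm (row_mx v s%:M) <= enorm v + `|s|.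
Proof.
rewrite -ler_sqr ?nnegrE ?addr_ge0 ?enorm_ge0// enorm_sqr.
rewrite /dotp big_split_ord/= big_ord1 !row_mxEr !mxE eqxx mulr1n.
under eq_bigr do rewrite row_mxEl.
rewrite -[X in X + _]/(dotp v v) -enorm_sqr -expr2 -(real_normK (num_real s)).
have := mulr_ge0 (enorm_ge0 v) (normr_ge0 s); nra.
Qed.

Lemma epi_lagrangianE (H : R -> 'rV[R]_n -> 'rV[R]_n -> R) t x :
  epi_lagrangian H t x = conjugate_epi (H t x).
Proof.
apply/seteqP; split => z /= zH.
  move=> p; rewrite dotp_row_mx lerBlDr -lerBlDl -lee_fin.
  by apply: le_trans zH; apply: ereal_sup_ubound; exists p.
apply: ge_ereal_sup => _ [p _ <-]; rewrite lee_fin lerBlDl -lerBlDr -dotp_row_mx.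
exact: zH.
Qed.

Lemma closed_conjugate_epi G : closed (conjugate_epi G).
Proof.
rewrite (_ : conjugate_epi G =
    \bigcap_p [set z | dotp z (row_mx p (- 1%:M)) <= G p]); last first.
  by apply/seteqP; split => z zG p; [move=> _|]; exact: zG.
apply: closed_bigI => p _; apply: (preimage_closed _ (@closed_le _ _)) => z _.
exact: dotp_continuousl.
Qed.

Lemma convex_conjugate_epi G (x z : 'rV[R]_(n + 1)) t : 0 <= t -> t <= 1 ->
  conjugate_epi G x -> conjugate_epi G z -> conjugate_epi G (t *: x + (1 - t) *: z).
Proof.
move=> t0 t1 xG zG p; rewrite dotpDl !dotpZl.
rewrite (_ : G p = t * G p + (1 - t) * G p); last by ring.
by rewrite lerD// ler_wpM2l// subr_ge0.
Qed.

(** The function [G p - dotp v p + |p|^2 / (2 mu)] attains its minimum over the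
    ball of radius [rho] at an interior point [u], because on the sphere it exceeds
    its value at 0. By convexity of [G], the optimality of [u] says that
    [v' = v - u / mu] is a subgradient of [G] at [u], whence the inequalities
    defining [conjugate_epi] hold for all [p], and not only on the ball. *)
Lemma conjugate_epi_proximal G v (eta rho mu : R) :
  convex_function [set: convex_lmodType 'rV[R]_n] G -> continuous G ->
  0 < rho -> 0 < mu -> eta + G 0 < rho ^+ 2 / (2 * mu) ->
  (forall p, enorm p <= rho -> dotp v p - G p <= eta) ->
  exists2 v', mu * enorm (v' - v) ^+ 2 <= eta + G 0 &
    conjugate_epi G (row_mx v' eta%:M).
Proof.
move=> cvxG cG rho0 mu0 rho_large le_eta.
pose f p := G p - dotp v p + (2 * mu)^-1 * enorm p ^+ 2.
have K0 : eball (0 : 'rV[R]_n) rho !=set0.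
  by exists 0; rewrite /eball/= subrr enorm0 ltW.
have cf : {within eball (0 : 'rV[R]_n) rho, continuous f}.
  apply: continuous_subspaceT => p; apply: (@cvgD _ _ _ (nbhs p)).
    apply: (@cvgB _ _ _ (nbhs p)); first exact: cG.
    exact: dotp_continuousr.
  apply: (@cvgM _ _ (nbhs p)); first exact: cvg_cst.
  by apply: (@cvgM _ _ (nbhs p)); exact: enorm_continuous.
have [u /set_mem] := EVT_min_rV K0 (@compact_eball _ _ _ _) cf.
rewrite /eball/= subr0 => u_le umin.
have {}umin p : enorm p <= rho -> f u <= f p.
  by move=> pr; apply: umin; apply/mem_set; rewrite /eball/= subr0.
have m20 : 0 < (2 * mu)^-1 by rewrite invr_gt0 mulr_gt0.
have u_lt : enorm u < rho.
  rewrite lt_neqAle u_le andbT; apply/eqP => urho.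
  have := umin 0; rewrite enorm0 (ltW rho0) => /(_ isT).
  rewrite /f enorm0 expr0n mulr0 dotp0r urho.
  by have := le_eta u u_le; rewrite mulrC in rho_large; lra.
pose v' := v - mu^-1 *: u.
have optimal q : G u + dotp v' (q - u) <= G q.
  apply/ler_addgt0Pr => eps eps0.
  have [t [t0 t1 tball tsmall]] : exists t, [/\ 0 < t, t <= 1,
      t * enorm (q - u) <= rho - enorm u &
      t * ((2 * mu)^-1 * enorm (q - u) ^+ 2) <= eps].
    pose a := enorm (q - u) + 1.
    pose b := (2 * mu)^-1 * enorm (q - u) ^+ 2 + 1.
    have a0 : 0 < a by rewrite ltr_wpDl// enorm_ge0.
    have b0 : 0 < b by rewrite ltr_wpDl// mulr_ge0 ?sqr_ge0// ltW.
    pose t := Num.min 1 (Num.min ((rho - enorm u) / a) (eps / b)).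
    have t0 : 0 < t by rewrite !lt_min ltr01 !divr_gt0// subr_gt0.
    have ta : t * a <= rho - enorm u.
      by rewrite -ler_pdivlMr// /t !ge_min lexx orbT.
    have tb : t * b <= eps by rewrite -ler_pdivlMr// /t !ge_min lexx !orbT.
    exists t; split => //; first by rewrite /t ge_min lexx.
      by apply: le_trans ta; rewrite ler_pM2l// lerDl.
    by apply: le_trans tb; rewrite ler_pM2l// lerDl.
  pose w := u + t *: (q - u).
  have wE : w = t *: q + (1 - t) *: u.
    by rewrite /w scalerBr scalerBl scale1r addrCA.
  have wr : enorm w <= rho.
    rewrite (le_trans (ler_enormD _ _))// enormZ (ger0_norm (ltW t0)).
    by rewrite -lerBrDl.
  have Gw := convex_function_le cvxG q u (ltW t0) t1.
  have := umin w wr; rewrite /f.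
  have -> : enorm w ^+ 2 = enorm u ^+ 2 + 2 * (t * dotp u (q - u))
      + t ^+ 2 * enorm (q - u) ^+ 2.
    rewrite !enorm_sqr /w; move: (q - u) => d.
    by rewrite dotpDl !dotpDr !dotpZl !dotpZr (dotpC d u); ring.
  have -> : dotp v w = dotp v u + t * dotp v (q - u) by rewrite /w dotpDr dotpZr.
  rewrite -wE in Gw => fw; rewrite /v' dotpBl dotpZl.
  have muE : mu^-1 = 2 * (2 * mu)^-1 by rewrite invfM mulrA divff ?mul1r.
  rewrite muE -(ler_pM2l t0).
  have := ler_wpM2l (ltW t0) tsmall; move: fw Gw.
  move: (2 * mu)^-1 (dotp v (q - u)) (dotp u (q - u)) (enorm (q - u)) => i a b c.
  rewrite !mulrDr; lra.
have v'E : v' - v = - (mu^-1 *: u) by rewrite /v' addrAC subrr add0r.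
have uu : mu * enorm (v' - v) ^+ 2 = mu^-1 * enorm u ^+ 2.
  rewrite v'E enormN enormZ exprMn ger0_norm ?invr_ge0 ?ltW//.
  by field; rewrite gt_eqF.
have bound q : dotp v' q - G q <= eta - mu^-1 * enorm u ^+ 2.
  have := optimal q; have := le_eta u u_le.
  rewrite dotpBr [dotp v' u]dotpBl dotpZl -enorm_sqr; lra.
exists v'.
  by have := bound 0; rewrite dotp0r uu; lra.
move=> q; rewrite dotp_row_mx row_mxKl row_mxKr mxE eqxx mulr1n.
have := bound q; have : 0 <= mu^-1 * enorm u ^+ 2.
  by rewrite mulr_ge0 ?sqr_ge0// invr_ge0 ltW.
lra.
Qed.

(** On the sphere of radius [2 c + 1] the quadratic term of the proximal function
    beats the linear lower bound. *)
Lemma conjugate_epi_neq0 G (c : R) :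
  convex_function [set: convex_lmodType 'rV[R]_n] G -> continuous G -> 0 <= c ->
  (forall p, G 0 - c * enorm p <= G p) -> conjugate_epi G !=set0.
Proof.
move=> cvxG cG c0 Gc.
have [||||v _ vG] := @conjugate_epi_proximal G 0 (c * (2 * c + 1) - G 0)
    (2 * c + 1) 1 cvxG cG; last by exists (row_mx v (c * (2 * c + 1) - G 0)%:M).
- by lra.
- by [].
- by rewrite subrK mulr1 ltr_pdivlMr// expr2; nra.
- move=> p pr; rewrite dotpC dotp0r sub0r; have := Gc p.
  have := ler_wpM2l c0 pr; lra.
Qed.

Variables (G_ : nat -> 'rV[R]_n -> R) (G : 'rV[R]_n -> R).
Hypothesis cvxG_ : forall N, convex_function [set: convex_lmodType 'rV[R]_n] (G_ N).
Hypothesis cG_ : forall N, continuous (G_ N).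
Hypothesis Gcvg : forall p eps, 0 < eps ->
  \forall p' \near p & N \near \oo, `|G_ N p' - G p| < eps.

Lemma pointwise_cvg p eps : 0 < eps -> \forall N \near \oo, `|G_ N p - G p| < eps.
Proof.
move=> eps0; have [[U V] [/= pU VN] UV] := Gcvg p eps0.
by apply: filterS VN => N VN; apply: (UV (p, N)); split => //; exact: nbhs_singleton.
Qed.

(** A point [(v, eta)] of the limit is approximated at height [eta + eps / 2]: the
    additional height absorbs the error made in replacing [G] by [G_ N] on a large
    ball, and beyond the ball the proximal construction takes over. *)
Lemma conjugate_epi_cvg : kuratowski_cvg (fun N => conjugate_epi (G_ N)) (conjugate_epi G).
Proof.
split => z.
  move=> /existsNP[p /negP]; rewrite -ltNge => Gp.
  pose e := (dotp z (row_mx p (- 1%:M)) - G p) / 2.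
  have e0 : 0 < e by rewrite divr_gt0// subr_gt0.
  near=> z' N => /(_ p); apply/negP; rewrite -ltNge.
  have GN : `|G_ N p - G p| < e by near: N; exact: pointwise_cvg.
  have zz' : dotp z (row_mx p (- 1%:M)) - e < dotp z' (row_mx p (- 1%:M)).
    near: z'; have /cvgr_gt := @dotp_continuousl _ _ (row_mx p (- 1%:M)) z.
    by apply; rewrite ltrBlDr ltrDl.
  by move: GN; rewrite ltr_distl /e in zz' *; lra.
move=> zG eps eps0.
set v := lsubmx z; set eta := rsubmx z 0 0.
have zE : z = row_mx v eta%:M by rewrite -mx11_scalar hsubmxK.
have vG p : dotp v p - G p <= eta.
  by have := zG p; rewrite dotp_row_mx -/v -/eta; lra.
have A0 : 0 <= eta + G 0 by have := vG 0; rewrite dotp0r; lra.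
pose A := eta + eps / 2 + G 0 + 1.
have {}A0 : 0 < A by rewrite /A; lra.
(* [mu] makes [A / mu < (eps / 2) ^+ 2], where [A / mu] bounds the squared distance
   from [v] to the proximal point; [rho] makes [rho ^+ 2 / (2 * mu)] exceed [A] *)
pose mu := 4 * (A + 1) / eps ^+ 2.
have mu0 : 0 < mu by rewrite divr_gt0 ?exprn_gt0//; lra.
pose rho := 2 * mu * A + 1.
have rho1 : 1 <= rho by have := mulr_gt0 mu0 A0; rewrite /rho; lra.
have rho0 : 0 < rho := lt_le_trans ltr01 rho1.
have e2 : 0 < eps / 2 by rewrite divr_gt0.
have ball : \forall N \near \oo, forall p, eball 0 rho p ->
    dotp v p - G_ N p <= eta + eps / 2.
  apply: (iffLR (compact_near_coveringP _) (@compact_eball _ _ 0 rho) _ _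
    (fun N p => dotp v p - G_ N p <= eta + eps / 2)) => p _.
  have e4 : 0 < eps / 4 by rewrite divr_gt0.
  have dv : \forall p' \near p, dotp v p' < dotp v p + eps / 4.
    by have /cvgr_lt := @dotp_continuousr _ _ v p; apply; rewrite ltrDl.
  have dv2 : \forall p' \near p & N \near \oo, dotp v p' < dotp v p + eps / 4.
    by exists ([set p' | dotp v p' < dotp v p + eps / 4], setT) => [|[p' N] []//];
      split => //; exact: filterT.
  apply: filterS2 (Gcvg p e4) dv2 => -[p' N] /=.
  by rewrite ltr_distl; have := vG p; lra.
near=> N.
have G0 : `|G_ N 0 - G 0| < 1 by near: N; exact: pointwise_cvg.
have [||v' v'v v'G] := @conjugate_epi_proximal (G_ N) v (eta + eps / 2) rho mu
    (cvxG_ N) (@cG_ N) rho0 mu0.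
- have mu20 : 0 < 2 * mu by lra.
  rewrite ltr_pdivlMr//; apply: (@lt_le_trans _ _ rho).
    apply: (@le_lt_trans _ _ (A * (2 * mu))); last by rewrite /rho; lra.
    apply: ler_wpM2r; first exact: ltW.
    by move: G0; rewrite ltr_distl /A; lra.
  by rewrite expr2 ler_peMl// ltW.
- move=> p pr; have : eball 0 rho p by rewrite /eball/= subr0.
  by move: p {pr}; near: N.
exists (row_mx v' (eta + eps / 2)%:M) => //.
rewrite zE opp_row_mx add_row_mx -raddfB/= addrAC subrr add0r.
apply: le_lt_trans (enorm_row_mx _ _) _.
rewrite (ger0_norm (ltW e2)) -ltrBrDr.
have -> : eps - eps / 2 = eps / 2 by lra.
rewrite -ltr_sqr ?nnegrE ?enorm_ge0 ?ltW//.
have : mu * enorm (v' - v) ^+ 2 < A + 1.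
  by apply: le_lt_trans v'v _; rewrite /A; move: G0; rewrite ltr_distl; lra.
rewrite -ltr_pdivlMl// => /lt_le_trans; apply.
rewrite le_eqVlt; apply/orP; left; apply/eqP; rewrite /mu.
by field; rewrite !gt_eqF//; lra.
Unshelve. all: by end_near. Qed.

End conjugate_epigraph.

(** * Uniform convergence along sequences *)
Section continuous_convergence.
Context {R : realType}.

Lemma uniform_cvg_ballP (U : choiceType) (V : pseudoMetricType R) (K : set U)
    (f_ : nat -> U -> V) (f : U -> V) :
  {uniform K, f_ @ \oo --> f} <->
  (forall eps, 0 < eps -> \forall N \near \oo, forall z, K z -> ball (f z) eps (f_ N z)).
Proof.
split => [fcvg eps eps0|fcvg P /uniform_nbhs[E [entE EP]]].
  have : nbhs (f : {uniform` K -> V}) [set h | forall z, K z -> ball (f z) eps (h z)].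
    apply/uniform_nbhs; exists [set xy | ball xy.1 eps xy.2]; split => //.
    by rewrite -entourage_ballE; exists eps.
  exact: fcvg.
have [eps /= eps0 epsE] : exists2 eps : R, 0 < eps & [set xy | ball xy.1 eps xy.2] `<=` E.
  by move: entE; rewrite -entourage_ballE => -[eps /= ? ?]; exists eps.
apply: filterS (fcvg eps eps0) => N fN; apply: EP => z Kz.
by apply: epsE; exact: fN.
Qed.

Lemma locally_uniform_near (Z : topologicalType) (f_ : nat -> Z -> R) (f : Z -> R)
    (K : set Z) z :
  {uniform K, f_ @ \oo --> f} -> nbhs z K -> {for z, continuous f} ->
  forall eps, 0 < eps -> \forall z' \near z & N \near \oo, `|f_ N z' - f z| < eps.
Proof.
move=> /uniform_cvg_ballP fcvg Kz fz eps eps0.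
have e2 : 0 < eps / 2 by rewrite divr_gt0.
have fcont : \forall z' \near z, `|f z - f z'| < eps / 2.
  by move/cvgrPdist_lt : fz => /(_ _ e2).
exists (K `&` [set z' | `|f z - f z'| < eps / 2],
    [set N | forall z, K z -> ball (f z) (eps / 2) (f_ N z)]).
  by split; [exact: filterI|exact: fcvg].
move=> [z' N] /= [[Kz' zz'] /(_ z' Kz')]; rewrite /ball/= => z'N.
rewrite distrC -(subrKA (f z')) (le_lt_trans (ler_normD _ _))// [ltRHS]splitr.
exact: ltrD.
Qed.

Lemma near_cvg_seq (Z : topologicalType) (f_ : nat -> Z -> R) (z_ : nat -> Z) (z : Z) (l : R) :
  (forall eps, 0 < eps -> \forall z' \near z & N \near \oo, `|f_ N z' - l| < eps) ->
  z_ N @[N --> \oo] --> z -> f_ N (z_ N) @[N --> \oo] --> l.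
Proof.
move=> fl zcvg; apply/cvgrPdist_lt => eps eps0.
have [[A B] [/= zA nB] AB] := fl eps eps0.
have zA' : \forall N \near \oo, A (z_ N) := zcvg _ zA.
apply: filterS2 zA' nB => N AN BN.
by rewrite distrC; exact: (AB (z_ N, N)).
Qed.

(** Sequences suffice because the neighbourhoods of a point of [Z] and those of
    [\oo] have countable bases; the index map [i] accounts for subsequences. *)
Lemma uniform_cvg_of_sequences (Z : pseudoMetricType R) (e_ : nat -> Z -> R)
    (e : Z -> R) (K : set Z) :
  compact K ->
  (forall (i : nat -> nat) (z_ : nat -> Z) (z : Z), i N @[N --> \oo] --> \oo ->
    z_ N @[N --> \oo] --> z -> e_ (i N) (z_ N) @[N --> \oo] --> e z) ->
  (forall (z_ : nat -> Z) (z : Z), z_ N @[N --> \oo] --> z -> e (z_ N) @[N --> \oo] --> e z) ->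
  forall eps, 0 < eps -> \forall N \near \oo, forall z, K z -> `|e z - e_ N z| < eps.
Proof.
move=> cK e_cvg e_cont eps eps0.
apply: (iffLR (compact_near_coveringP K) cK _ _ (fun N z => `|e z - e_ N z| < eps)).
move=> z _; apply: contrapT => far.
have /choice[w wfar] : forall k : nat, exists w : Z * nat,
    [/\ ball z k.+1%:R^-1 w.1, (k <= w.2)%N & eps <= `|e w.1 - e_ w.2 w.1|].
  move=> k; apply: contrapT => near_k; apply: far.
  exists (ball z k.+1%:R^-1, [set N | (k <= N)%N]).
    by split; [apply: nbhsx_ballx; rewrite invr_gt0|exists k].
  move=> [z' N] /= [zz' kN]; rewrite ltNge; apply/negP => farN.
  by apply: near_k; exists (z', N).
have zcvg : (w N).1 @[N --> \oo] --> z.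
  apply/cvg_ballP => r r0; near=> N.
  have [zw _ _] := wfar N; apply: le_ball zw; apply: ltW.
  by near: N; exact: near_infty_natSinv_lt (PosNum r0).
have icvg : (w N).2 @[N --> \oo] --> \oo.
  move=> A [k _ kA]; exists k => // N /= kN; apply: kA => /=.
  by have [_ Nw _] := wfar N; exact: leq_trans kN Nw.
have diff : e (w N).1 - e_ (w N).2 (w N).1 @[N --> \oo] --> e z - e z.
  by apply: cvgB; [exact: e_cont|exact: (e_cvg (fun N => (w N).2))].
rewrite subrr in diff; move/cvgr0Pnorm_lt : diff => /(_ eps eps0)[k _ /(_ k)].
by have [_ _] := wfar k; rewrite /= leNgt => /negP + /(_ (leqnn k)).
Unshelve. all: by end_near. Qed.

End continuous_convergence.

(** * The canonical representation *)
Section canonical_representation.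
Context {R : realType} {n : nat}.
Implicit Types (T t : R).

Lemma nbhs_eball_set (x : 'rV[R]_n) : nbhs x (eball x 1).
Proof. by apply: filterS (nbhs_eball x ltr01) => z; rewrite /eball/= => /ltW. Qed.

Lemma ball_lsubmx (z w : 'rV[R]_(n + 1)) eps : 0 < eps ->
  (forall j : 'I_n, `|z 0 (lshift 1 j) - w 0 (lshift 1 j)| < eps) ->
  ball (lsubmx z) eps (lsubmx w).
Proof. by move=> eps0 zw; split => // i j; rewrite ord1 !mxE; exact: zw. Qed.

Lemma ball_rsubmx (z w : 'rV[R]_(n + 1)) eps :
  `|z 0 (rshift n 0) - w 0 (rshift n 0)| < eps ->
  ball (rsubmx z 0 0) eps (rsubmx w 0 0).
Proof. by move=> zw; rewrite !mxE. Qed.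

(** The epigraphs converge because the Hamiltonians converge continuously, and the
    centres at which they are clipped converge with the radii. *)
Lemma canonical_e_cvg T
    (H_ : nat -> R -> 'rV[R]_n -> 'rV[R]_n -> R) (c_ : nat -> R -> R)
    (lam_ : nat -> R -> 'rV[R]_n -> R)
    (H : R -> 'rV[R]_n -> 'rV[R]_n -> R) (c : R -> R) (lam : R -> 'rV[R]_n -> R)
    t (x_ : nat -> 'rV[R]_n) (x : 'rV[R]_n)
    (a_ : nat -> 'rV[R]_(n + 1)) (a : 'rV[R]_(n + 1)) j :
  (forall N, boundedly_admissible T (H_ N) (c_ N) (lam_ N)) ->
  boundedly_admissible T H c lam -> t \in `[0, T] ->
  {family compact,
    (fun N (z : 'rV[R]_n * 'rV[R]_n) => H_ N t z.1 z.2) @ \oo -->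
    (fun z : 'rV[R]_n * 'rV[R]_n => H t z.1 z.2)} ->
  {family compact, (fun N => lam_ N t) @ \oo --> lam t} ->
  c_ N t @[N --> \oo] --> c t ->
  x_ N @[N --> \oo] --> x -> a_ N @[N --> \oo] --> a ->
  canonical_e (H_ N) (c_ N) (lam_ N) t (x_ N) (a_ N) 0 j @[N --> \oo] -->
  canonical_e H c lam t x a 0 j.
Proof.
move=> adm_ adm tT cvgH cvglam cvgc xcvg acvg.
have Hnear z eps : 0 < eps ->
    \forall z' \near z & N \near \oo, `|H_ N t z'.1 z'.2 - H t z.1 z.2| < eps.
  apply: (locally_uniform_near (K := eball z.1 1 `*` eball z.2 1)
    (f_ := fun N z => H_ N t z.1 z.2) (f := fun z => H t z.1 z.2)).
  - move/fam_cvgP : cvgH; apply; apply: compact_setX; exact: compact_eball.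
  - by exists (eball z.1 1, eball z.2 1); [split; exact: nbhs_eball_set|].
  - exact: (adm_continuous adm tT).
have Hcvg0 : H_ N t (x_ N) 0 @[N --> \oo] --> H t x 0.
  apply: (near_cvg_seq (f_ := fun N z => H_ N t z.1 z.2) (z_ := fun N => (x_ N, 0))
    (Hnear (x, 0))).
  exact: (cvg_pair xcvg (cvg_cst _)).
have lamcvg : lam_ N t (x_ N) @[N --> \oo] --> lam t x.
  apply: (near_cvg_seq (f_ := fun N => lam_ N t) (z := x)) => //.
  apply: (locally_uniform_near (K := eball x 1)).
  - by move/fam_cvgP : cvglam; apply; exact: compact_eball.
  - exact: nbhs_eball_set.
  - exact: (adm_lam_continuous adm tT).
have radius_cvg : canonical_radius (H_ N) (c_ N) (lam_ N) t (x_ N) @[N --> \oo] -->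
    canonical_radius H c lam t x.
  apply: cvgD; last exact: cvg_cst.
  apply: cvgD; first by apply: cvgD; apply: cvg_norm.
  apply: cvgM => //; apply: cvgD; [exact: cvg_cst|exact: cvg_enorm].
have cont G d l (u : 'rV[R]_n) : boundedly_admissible T G d l -> continuous (G t u).
  move=> admG; suff G_cvg (p : 'rV[R]_n) : G t u p' @[p' --> p] --> G t u p by exact: G_cvg.
  have cu : u @[_ --> p] --> u := @cvg_cst _ u _ (nbhs p) (nbhs_filter p).
  have up : (u, p') @[p' --> p] --> (u, p) :=
    @cvg_pair _ _ _ _ _ _ (nbhs_filter p) (nbhs_filter u) (nbhs_filter p) _ _ cu cvg_id.
  by have := cvg_comp _ _ up (@adm_continuous _ _ _ _ _ _ admG t tT (u, p)); exact.
have neq0 G d l (u : 'rV[R]_n) : boundedly_admissible T G d l -> conjugate_epi (G t u) !=set0.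
  move=> admG; apply: (@conjugate_epi_neq0 _ _ _ (d t * (1 + enorm u))).
  - exact: (adm_convex admG u tT).
  - exact: (cont _ _ _ _ admG).
  - by rewrite mulr_ge0 ?addr_ge0 ?enorm_ge0// (adm_c_ge0 admG).
  - move=> p; have := adm_lipschitz admG u p 0 tT.
    by rewrite subr0 ler_distl => /andP[].
rewrite /canonical_e epi_lagrangianE; under eq_fun do rewrite epi_lagrangianE.
apply: (@steiner_point_clip_cvg _ _ (fun N => conjugate_epi (H_ N t (x_ N))) _
  (fun N => canonical_radius (H_ N) (c_ N) (lam_ N) t (x_ N) *: a_ N)).
- by move=> N; exact: (neq0 _ _ _ _ (adm_ N)).
- by move=> N; exact: closed_conjugate_epi.
- exact: (neq0 _ _ _ _ adm).
- exact: closed_conjugate_epi.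
- apply: conjugate_epi_cvg.
  + by move=> N; exact: (adm_convex (adm_ N) (x_ N) tT).
  + by move=> N; exact: (cont _ _ _ _ (adm_ N)).
  move=> p eps eps0; have [[A B] [[[A1 A2] [/= xA1 pA2] A12] nB] AB] := Hnear (x, p) eps eps0.
  exists (A2, B `&` [set N | A1 (x_ N)]).
    by split => //; apply: filterI => //; exact: (xcvg A1 xA1).
  move=> [p' N] /= [A2p' [BN A1x]].
  by apply: (AB ((x_ N, p'), N)); split => //; apply: A12.
- exact: cvgZ.
- exact: convex_conjugate_epi.
Qed.

End canonical_representation.

Unset Implicit Arguments.

Theorem theorem3p12 (R : realType) (n : nat) (T : R)
    (H_ : nat -> R -> 'rV[R]_n -> 'rV[R]_n -> R)
    (c_ : nat -> R -> R) (lam_ : nat -> R -> 'rV[R]_n -> R)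
    (H : R -> 'rV[R]_n -> 'rV[R]_n -> R)
    (c : R -> R) (lam : R -> 'rV[R]_n -> R)
    (adm_ : forall i, boundedly_admissible T (H_ i) (c_ i) (lam_ i))
    (adm : boundedly_admissible T H c lam)
    (cvgH : forall t, t \in `[0, T] ->
      {family compact,
        (fun i (z : 'rV[R]_n * 'rV[R]_n) => H_ i t z.1 z.2) @ \oo -->
        (fun z : 'rV[R]_n * 'rV[R]_n => H t z.1 z.2)})
    (cvglam : forall t, t \in `[0, T] ->
      {family compact, (fun i => lam_ i t) @ \oo --> lam t})
    (cvgc : forall t, t \in `[0, T] -> c_ i t @[i --> \oo] --> c t) :
  forall t, t \in `[0, T] ->
  forall K : set ('rV[R]_n * 'rV[R]_(n + 1)),
    compact K -> K `<=` [set: 'rV[R]_n] `*` eball 0 1 ->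
    {uniform K,
      (fun i z => canonical_f (H_ i) (c_ i) (lam_ i) t z.1 z.2) @ \oo -->
      (fun z => canonical_f H c lam t z.1 z.2)} /\
    {uniform K,
      (fun i z => canonical_l (H_ i) (c_ i) (lam_ i) t z.1 z.2) @ \oo -->
      (fun z => canonical_l H c lam t z.1 z.2)}.
Proof.
move=> t tT K cK _.
have coord j eps : 0 < eps -> \forall N \near \oo, forall z, K z ->
    `|canonical_e H c lam t z.1 z.2 0 j -
      canonical_e (H_ N) (c_ N) (lam_ N) t z.1 z.2 0 j| < eps.
  apply: (@uniform_cvg_of_sequences _ _
    (fun N z => canonical_e (H_ N) (c_ N) (lam_ N) t z.1 z.2 0 j)
    (fun z => canonical_e H c lam t z.1 z.2 0 j)) => //.
  - move=> i z_ z icvg zcvg.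
    apply: (canonical_e_cvg (T := T) (H_ := H_ \o i) (c_ := c_ \o i)
      (lam_ := lam_ \o i)) => //.
    + by move=> N; exact: adm_.
    + exact: (cvg_comp _ _ icvg (cvgH t tT)).
    + exact: (cvg_comp _ _ icvg (cvglam t tT)).
    + exact: (cvg_comp _ _ icvg (cvgc t tT)).
    + exact: (cvg_comp _ _ zcvg cvg_fst).
    + exact: (cvg_comp _ _ zcvg cvg_snd).
  - move=> z_ z zcvg.
    apply: (canonical_e_cvg (T := T) (H_ := fun=> H) (c_ := fun=> c)
      (lam_ := fun=> lam)) => //.
    + apply/fam_cvgP => A _; apply/uniform_cvg_ballP => r r0.
      by apply: nearW => N w _; exact: ballxx.
    + apply/fam_cvgP => A _; apply/uniform_cvg_ballP => r r0.
      by apply: nearW => N w _; exact: ballxx.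
    + exact: cvg_cst.
    + exact: (cvg_comp _ _ zcvg cvg_fst).
    + exact: (cvg_comp _ _ zcvg cvg_snd).
split; apply/uniform_cvg_ballP => eps eps0.
  have : \forall N \near \oo, forall (j : 'I_n) z, K z ->
      `|canonical_e H c lam t z.1 z.2 0 (lshift 1 j) -
        canonical_e (H_ N) (c_ N) (lam_ N) t z.1 z.2 0 (lshift 1 j)| < eps.
    by apply: filter_forall => j; exact: coord.
  by apply: filterS => N eN z Kz; apply: ball_lsubmx => // j; exact: eN.
apply: filterS (coord (rshift n 0) eps eps0) => N eN z Kz.
by apply: ball_rsubmx; exact: eN.
Qed.
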